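(* Let $\alpha>-1$, let $f$ be an $\alpha$-harmonic function in $\mathbb{D}$ with boundary function $f^{*}$, and suppose that $f^{*}\in C(\mathbb{T})$ and that $\sup_{z\in\overline{\mathbb{D}}}|f(z)|\le M$, where $M$ is a constant. Then for every $z\in\mathbb{D}$, $$|Df(z)|\le \frac{M(\alpha+2)}{c_\alpha}\cdot\frac{1}{1-|z|}\le \frac{2M(\alpha+2)}{c_\alpha}\cdot\frac{1}{1-|z|^2},$$ where $c_\alpha=\dfrac{(\Gamma(\frac{\alpha}{2}+1))^2}{\Gamma(\alpha+1)}$. In particular, if $f$ maps $\mathbb{D}$ into $\mathbb{D}$, then for every $z\in\mathbb{D}$, $$|Df(z)|\le\frac{2(\alpha+2)}{c_\alpha}\cdot\frac{1}{1-|z|^2}.$$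
   Context: $\mathbb{D}=\{z\in\mathbb{C}:|z|<1\}$ and $\mathbb{T}=\partial\mathbb{D}$. $\Gamma(s)=\int_0^\infty t^{s-1}e^{-t}\,dt$ $(s>0)$ is the Gamma function. Put $\frac{\partial}{\partial z}=\frac12\left(\frac{\partial}{\partial x}-i\frac{\partial}{\partial y}\right)$ and $\frac{\partial}{\partial\overline z}=\frac12\left(\frac{\partial}{\partial x}+i\frac{\partial}{\partial y}\right)$. For $\alpha>-1$, a complex-valued function $f$ is $\alpha$-harmonic in $\mathbb{D}$ if it is twice continuously differentiable in $\mathbb{D}$ and satisfies $\frac{\partial}{\partial z}\left((1-|z|^2)^{-\alpha}\frac{\partial f}{\partial\overline z}\right)=0$ in $\mathbb{D}$. Standing assumption: every $\alpha$-harmonic function $f$ considered has a boundary function $f^*$, in the sense that $f_r\to f^*$ in $\mathcal{D}'(\mathbb{T})$ as $r\to1^-$, where $f_r(e^{i\theta})=f(re^{i\theta})$, and is represented in $\mathbb{D}$ by $$f(z)=\frac1{2\pi}\int_0^{2\pi}\mathcal{P}_\alpha(ze^{-i\theta})f^*(e^{i\theta})\,d\theta,\qquad \mathcal{P}_\alpha(z)=\frac{(1-|z|^2)^{\alpha+1}}{(1-z)(1-\overline z)^{\alpha+1}}.$$ On $\mathbb{T}$ the values of $f$ are those of $f^*$. $Df(z)$ is the (real $2\times2$) Jacobian matrix of $f$ at $z$, and $|Df(z)|=\sup\{|Df(z)\varsigma|:|\varsigma|=1\}=|f_z(z)|+|f_{\overline z}(z)|$ is its operator norm. *)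

(* Defs.v *)
From Stdlib Require Import Reals.
From Coquelicot Require Import Coquelicot.

Open Scope R_scope.

Definition in_disk (z : C) : Prop := Cmod z < 1.
Definition in_closed_disk (z : C) : Prop := Cmod z <= 1.
Definition on_circle (z : C) : Prop := Cmod z = 1.

Definition expi (t : R) : C := (cos t, sin t).

Definition Gamma (s : R) : R :=
  RInt_gen (fun t => Rpower t (s - 1) * exp (- t))
           (at_right 0) (Rbar_locally p_infty).

Definition c_alpha (alpha : R) : R :=
  (Gamma (alpha / 2 + 1)) ^ 2 / Gamma (alpha + 1).

(** Principal branch of [w ^ s] (real [s]), meaningful for [0 < Re w], where
    the principal argument is [atan (Im w / Re w)].  It is only applied to
    [1 - conj z] with [|z| < 1], whose real part is positive. *)
Definition Cpow_right (w : C) (s : R) : C :=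
  (RtoC (Rpower (Cmod w) s) * expi (s * atan (Im w / Re w)))%C.

Definition P_alpha (alpha : R) (z : C) : C :=
  (RtoC (Rpower (1 - Cmod z ^ 2) (alpha + 1))
   / ((1 - z) * Cpow_right (1 - Cconj z) (alpha + 1)))%C.

(** Componentwise partial derivatives of [f] in the real coordinates
    [z = (x, y)]. *)
Definition partial_x (f : C -> C) (z : C) : C :=
  (Derive (fun x => Re (f (x, Im z))) (Re z),
   Derive (fun x => Im (f (x, Im z))) (Re z)).

Definition partial_y (f : C -> C) (z : C) : C :=
  (Derive (fun y => Re (f (Re z, y))) (Im z),
   Derive (fun y => Im (f (Re z, y))) (Im z)).

Definition d_z (f : C -> C) (z : C) : C :=
  (RtoC (1 / 2) * (partial_x f z - Ci * partial_y f z))%C.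

Definition d_zbar (f : C -> C) (z : C) : C :=
  (RtoC (1 / 2) * (partial_x f z + Ci * partial_y f z))%C.

(** [ex_diff_n _ 2 x y] at every point of the open disk: the partial
    derivatives of order at most 2 exist and are continuous there. *)
Definition C2_on_disk (f : C -> C) : Prop :=
  forall z : C, in_disk z ->
    ex_diff_n (fun x y => Re (f (x, y))) 2 (Re z) (Im z) /\
    ex_diff_n (fun x y => Im (f (x, y))) 2 (Re z) (Im z).

Definition alpha_harmonic (alpha : R) (f : C -> C) : Prop :=
  C2_on_disk f /\
  forall z : C, in_disk z ->
    d_z (fun w => (RtoC (Rpower (1 - Cmod w ^ 2) (- alpha)) * d_zbar f w)%C) z
    = RtoC 0.

Definition CRInt (g : R -> C) (a b : R) : C :=
  RInt (V := C_R_CompleteNormedModule) g a b.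

(** Test functions on the circle: only the values of [phi] on the circle
    matter. *)
Definition smooth_on_circle (phi : C -> C) : Prop :=
  forall (n : nat) (t : R),
    ex_derive_n (fun s => Re (phi (expi s))) n t /\
    ex_derive_n (fun s => Im (phi (expi s))) n t.

Definition circle_pairing (g phi : C -> C) : C :=
  (RtoC (/ (2 * PI))
   * CRInt (fun t => (g (expi t) * phi (expi t))%C) 0 (2 * PI))%C.

(** [f_r -> fstar] in the sense of distributions as [r -> 1-], for a boundary
    function [fstar] acting on test functions by integration. *)
Definition distributional_limit (f fstar : C -> C) : Prop :=
  forall phi : C -> C, smooth_on_circle phi ->
    filterlim (fun r : R => circle_pairing (fun w => f (RtoC r * w)%C) phi)
              (at_left 1) (locally (circle_pairing fstar phi)).

Definition poisson_represented (alpha : R) (f fstar : C -> C) : Prop :=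
  forall z : C, in_disk z ->
    f z = (RtoC (/ (2 * PI))
           * CRInt (fun t => P_alpha alpha (z * expi (- t)) * fstar (expi t))
                   0 (2 * PI))%C.

Definition has_boundary_function (alpha : R) (f fstar : C -> C) : Prop :=
  distributional_limit f fstar /\ poisson_represented alpha f fstar.

(** [f] on the open disk, [fstar] on its boundary. *)
Definition closed_disk_extension (f fstar : C -> C) (z : C) : C :=
  if Rlt_dec (Cmod z) 1 then f z else fstar z.

Definition sup_closed_disk (g : C -> C) : Rbar :=
  Lub_Rbar (fun y => exists z : C, in_closed_disk z /\ y = Cmod (g z)).

(** The real Jacobian matrix of [f] at [z] applied to the vector [v] of the
    Euclidean plane [C = R * R]. *)
Definition jacobian_apply (f : C -> C) (z v : C) : C :=
  (Re (partial_x f z) * Re v + Re (partial_y f z) * Im v,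
   Im (partial_x f z) * Re v + Im (partial_y f z) * Im v).

Definition jacobian_norm (f : C -> C) (z : C) : Rbar :=
  Lub_Rbar (fun y => exists v : C, Cmod v = 1 /\ y = Cmod (jacobian_apply f z v)).

(* Main.v *)
(** Write [s = alpha / 2].  Differentiating the Poisson integral under the integral sign and
    estimating the logarithmic derivatives of the kernel gives
    [|DP_alpha (z) v| <= |P_alpha z| (alpha + 2) / (1 - |z|)] for unit [v], so everything rests
    on bounding the mean of [|P_alpha|] over the circle of radius [r] by [1 / c_alpha].

    A Moebius substitution turns that mean into [I_s r], the mean of [|1 - r e^{it}|^{2s}].
    It increases with [r]: by the involution [D -> (1 - r^2)^2 / D] of [D = |1 - r e^{it}|^2], its
    derivative is the mean of a quantity of constant sign.  Integrating the derivative of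
    [sin t * D^s] gives a three-term recurrence in [s] which degenerates, as [r -> 1], to the
    recurrence [(s + 1) g (s + 1) = 2 (2 s + 1) g s] of [g s = Gamma (2s + 1) / Gamma (s + 1)^2].
    Hence [sup_r I_s r / g s] does not exceed [sup_r I_{s+n} r / g (s + n)] for any [n], and
    convexity estimates between consecutive integers show that the latter has upper limit at most 1.

    When [f] maps the disk into itself, testing [f_r -> f^*] against the powers
    [((1 + cos (t - t0)) / 2)^n], which concentrate at [t0], gives [|f^*| <= 1]. *)
Require Import Defs.
From Stdlib Require Import Reals Lra Lia.
From Coquelicot Require Import Coquelicot.

Open Scope R_scope.

(** * The Gamma function *)

(** [gamma_ratio s] is the value of the mean at [r = 1], a central binomial coefficient at real
    argument. At [r = 1] the base [|1 - e^{it}|] vanishes at a point, so for negative [s] the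
    integral becomes improper; hence only [r < 1] is used, with one-sided inequalities and
    monotonicity in [r] in place of limits. The recurrence serves in both directions. Upwards it
    bounds the mean at the integers from the trivial value at [s = 0]; for other real [s] no such
    starting value is at hand, so the bound is brought down from [s + n]. On the way down the last
    term of the recurrence has the wrong sign when [s > 0], and it is absorbed by comparing the
    means with exponents [s - 1] and [s]. The estimate at [s + n] avoids Stirling's formula: tangent
    inequalities for powers, integrated against Gamma densities and over the circle, lose only a
    factor that tends to 1. *)

Lemma exp_mono (x y : R) : x <= y -> exp x <= exp y.
Proof.
  intros [H| ->]; [left; now apply exp_increasing|apply Rle_refl].
Qed.

Lemma ln_le_sub1 (u : R) : 0 < u -> ln u <= u - 1.
Proof.
  intros Hu. pose proof (exp_ineq1_le (ln u)) as H. rewrite exp_ln in H; lra.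
Qed.

Lemma ln_ge_1_sub_inv (u : R) : 0 < u -> 1 - / u <= ln u.
Proof.
  intros Hu. pose proof (ln_le_sub1 (/ u) (Rinv_0_lt_compat _ Hu)) as H.
  rewrite ln_Rinv in H; lra.
Qed.

Lemma Rpower_pos (x y : R) : 0 < Rpower x y.
Proof. apply exp_pos. Qed.

(** The concave function [t^th] lies below its tangent at [c]. Being affine in [t], the bound
    integrates to a combination of two quantities whose exponents differ by 1. *)
Lemma Rpower_Bernoulli_le (t c th : R) :
  0 < t -> 0 < c -> 0 <= th <= 1 ->
  Rpower t th <= Rpower c th * ((1 - th) + th * (t / c)).
Proof.
  intros Ht Hc Hth.
  assert (Hu : 0 < t / c) by (apply Rdiv_lt_0_compat; lra).
  set (u := t / c) in *.
  assert (Htu : t = c * u) by (unfold u; field; lra).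
  assert (Hy : 0 < (1 - th) + th * u) by nra.
  set (y := (1 - th) + th * u) in *.
  rewrite Htu, <- Rpower_mult_distr by lra.
  apply Rmult_le_compat_l; [left; apply Rpower_pos|].
  rewrite <- (exp_ln y Hy). unfold Rpower. apply exp_mono.
  pose proof (ln_le_sub1 (u / y)) as H1. pose proof (ln_le_sub1 (/ y)) as H2.
    assert (0 < / y) by now apply Rinv_0_lt_compat.
    assert (0 < u / y) by now apply Rdiv_lt_0_compat.
    specialize (H1 ltac:(assumption)). specialize (H2 ltac:(assumption)).
    unfold Rdiv in H1. rewrite ln_mult, ln_Rinv in H1 by assumption.
    rewrite ln_Rinv in H2 by assumption.
    (* [y] is the weighted mean of [u] and 1, so the right-hand sides of the two logarithm bounds
       cancel: this is Jensen's inequality for [ln]. *)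
    assert (E : th * (u * / y - 1) + (1 - th) * (/ y - 1) = 0).
    { unfold y. field. fold y. lra. }
  nra.
Qed.

(** A tangent in the variable [1 / t], in which [t^p] is convex for every [p >= 0]; in the variable
    [t] convexity would fail for [0 < p < 1]. The factor [1 / t] again shifts an exponent by only
    1. *)
Lemma Rpower_tangent_ge (t c p : R) :
  0 < t -> 0 < c -> 0 <= p ->
  Rpower c p * (1 + p - p * (c / t)) <= Rpower t p.
Proof.
  intros Ht Hc Hp.
  assert (Hu : 0 < t / c) by (apply Rdiv_lt_0_compat; lra).
  set (u := t / c) in *.
  assert (Htu : t = c * u) by (unfold u; field; lra).
  replace (c / t) with (/ u) by (unfold u; field; lra).
  rewrite Htu, <- Rpower_mult_distr by lra.
  apply Rmult_le_compat_l; [left; apply Rpower_pos|].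
  pose proof (exp_ineq1_le (p * ln u)). pose proof (ln_ge_1_sub_inv u Hu).
  unfold Rpower. nra.
Qed.

(** * Convergence of the Gamma integral *)

Definition gamma_integrand (s t : R) : R := Rpower t (s - 1) * exp (- t).

Lemma gamma_integrand_pos (s t : R) : 0 < gamma_integrand s t.
Proof. apply Rmult_lt_0_compat; apply exp_pos. Qed.

Lemma continuous_gamma_integrand (s t : R) :
  0 < t -> continuous (gamma_integrand s) t.
Proof.
  intros Ht. apply (ex_derive_continuous (gamma_integrand s)).
  unfold gamma_integrand, Rpower. auto_derive. lra.
Qed.

Lemma filter_prod_pos_le :
  filter_prod (at_right 0) (Rbar_locally p_infty)
    (fun ab : R * R => 0 < fst ab <= snd ab).
Proof.
  exists (fun a => 0 < a < 1) (fun b => 1 < b).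
  - exists (mkposreal 1 Rlt_0_1). intros y Hy Hy0. split; [exact Hy0|].
    unfold ball in Hy; simpl in Hy; unfold AbsRing_ball, abs, minus, plus, opp in Hy; simpl in Hy.
    apply Rabs_def2 in Hy. lra.
  - exists 1. trivial.
  - simpl. intros; lra.
Qed.

Lemma ex_RInt_pos (f : R -> R) (a b : R) :
  (forall t, 0 < t -> continuous f t) -> 0 < a -> 0 < b -> ex_RInt f a b.
Proof.
  intros Hc Ha Hb. apply (ex_RInt_continuous f). intros z [Hz _]. apply Hc.
  apply Rlt_le_trans with (2 := Hz). apply Rmin_glb_lt; assumption.
Qed.

Lemma is_RInt_gen_ge_0 (f : R -> R) (l : R) :
  (forall t, 0 < t -> 0 <= f t) ->
  is_RInt_gen f (at_right 0) (Rbar_locally p_infty) l -> 0 <= l.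
Proof.
  intros Hf Hl. apply Rnot_lt_le. intros Hneg.
  assert (HP : locally l (fun y => y < 0)).
  { apply (open_lt 0 l). exact Hneg. }
  specialize (Hl _ HP). unfold filtermapi in Hl.
  pose proof (filter_and _ _ Hl filter_prod_pos_le) as H.
  apply filter_ex in H. destruct H as [[a b] [[y [Hy Hy0]] Hab]]. simpl in *.
  assert (0 <= y).
  { rewrite <- (is_RInt_unique _ _ _ _ Hy). apply RInt_ge_0; [lra| |].
    - now exists y.
    - intros x Hx. apply Hf. lra. }
  lra.
Qed.

Lemma is_RInt_gen_le (f g : R -> R) (l m : R) :
  (forall t, 0 < t -> f t <= g t) ->
  is_RInt_gen f (at_right 0) (Rbar_locally p_infty) l ->
  is_RInt_gen g (at_right 0) (Rbar_locally p_infty) m -> l <= m.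
Proof.
  intros Hfg Hf Hg.
  pose proof (is_RInt_gen_minus _ _ _ _ Hg Hf) as H.
  apply is_RInt_gen_ge_0 in H.
  - unfold minus, plus, opp in H; simpl in H. lra.
  - intros t Ht. specialize (Hfg t Ht). unfold minus, plus, opp; simpl. lra.
Qed.

(** The limit is the supremum of the integrals over compact subintervals. Enlarging an interval
    increases the integral, so one nearly optimal interval controls both ends at once. *)
Lemma ex_RInt_gen_of_bounded (f : R -> R) (B : R) :
  (forall t, 0 < t -> continuous f t) -> (forall t, 0 < t -> 0 <= f t) ->
  (forall a b, 0 < a <= b -> RInt f a b <= B) ->
  ex_RInt_gen f (at_right 0) (Rbar_locally p_infty).
Proof.
  intros Hc Hpos HB.
  destruct (completeness (fun y => exists a b, 0 < a <= b /\ y = RInt f a b))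
    as [l [Hub Hlub]].
  - exists B. intros y [a [b [Hab ->]]]. now apply HB.
  - exists (RInt f 1 1), 1, 1. split; [lra|reflexivity].
  - exists l. intros P [eps HP].
    assert (H : exists a0 b0, 0 < a0 <= b0 /\ l - eps < RInt f a0 b0).
    { destruct (Classical_Prop.classic
        (exists a0 b0, 0 < a0 <= b0 /\ l - eps < RInt f a0 b0)) as [H|H]; [exact H|].
      exfalso. assert (l <= l - eps).
      { apply Hlub. intros y [a [b [Hab ->]]]. apply Rnot_lt_le. intros Hlt.
        apply H. now exists a, b. }
      destruct eps as [e He]; simpl in *; lra. }
    destruct H as [a0 [b0 [Hab0 Hlt]]].
    exists (fun a => 0 < a < a0) (fun b => b0 < b).
    + assert (Ha0 : 0 < a0) by lra.
      exists (mkposreal a0 Ha0). intros y Hy Hy0. split; [exact Hy0|].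
      unfold ball in Hy; simpl in Hy; unfold AbsRing_ball, abs, minus, plus, opp in Hy; simpl in Hy.
      apply Rabs_def2 in Hy. lra.
    + now exists b0.
    + intros a b Ha Hb. simpl. exists (RInt f a b). split.
      * apply (RInt_correct f). apply ex_RInt_pos; try assumption; lra.
      * apply HP. unfold ball; simpl; unfold AbsRing_ball, abs, minus, plus, opp; simpl.
        assert (H1 : RInt f a b <= l). { apply Hub. exists a, b. split; [lra|reflexivity]. }
        assert (H2 : RInt f a0 b0 <= RInt f a b).
        { rewrite <- (RInt_Chasles f a a0 b) by (apply ex_RInt_pos; try assumption; lra).
          rewrite <- (RInt_Chasles f a0 b0 b) by (apply ex_RInt_pos; try assumption; lra).
          assert (0 <= RInt f a a0).
          { apply RInt_ge_0; [lra|apply ex_RInt_pos; try assumption; lra|].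
            intros x Hx; apply Hpos; lra. }
          assert (0 <= RInt f b0 b).
          { apply RInt_ge_0; [lra|apply ex_RInt_pos; try assumption; lra|].
            intros x Hx; apply Hpos; lra. }
          unfold plus; simpl. lra. }
        apply Rabs_def1; lra.
Qed.

(** The constant is the maximum of [y^p e^{-y}], attained at [y = p]. *)
Lemma Rpower_le_exp (p y : R) : 0 < p -> 0 < y ->
  Rpower y p <= exp (p * ln p - p) * exp y.
Proof.
  intros Hp Hy. unfold Rpower. rewrite <- exp_plus.
  pose proof (ln_le_sub1 (y / p) ltac:(apply Rdiv_lt_0_compat; lra)) as H.
  unfold Rdiv in H. rewrite ln_mult, ln_Rinv in H;
    [|lra|lra|now apply Rinv_0_lt_compat].
  apply exp_mono.
  apply Rmult_le_compat_l with (r := p) in H; [|lra].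
  replace (p * (y * / p - 1)) with (y - p) in H by (field; lra). lra.
Qed.

(* The integrand is dominated by a multiple of the derivative of [(t/(1+t))^s], which stays below 1. *)
Lemma ex_RInt_gen_gamma (s : R) : 0 < s ->
  ex_RInt_gen (gamma_integrand s) (at_right 0) (Rbar_locally p_infty).
Proof.
  intros Hs.
  (* The maximum of [y^(s+1) e^{-y}], used at [y = 1 + t], whence the extra factor [exp 1]. *)
  set (K := exp ((s + 1) * ln (s + 1) - (s + 1)) * exp 1).
  assert (HK : 0 < K) by (apply Rmult_lt_0_compat; apply exp_pos).
  apply (ex_RInt_gen_of_bounded _ (K / s)).
  - intros; now apply continuous_gamma_integrand.
  - intros; left; apply gamma_integrand_pos.
  - intros a b Hab.
    set (F := fun t => K / s * exp (s * (ln t - ln (1 + t)))).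
    set (dF := fun t => K * (exp (s * (ln t - ln (1 + t))) * / (t * (1 + t)))).
    assert (HF : is_RInt dF a b (minus (F b) (F a))).
    { apply (is_RInt_derive F dF); intros x Hx;
        rewrite Rmin_left, Rmax_right in Hx by lra.
      - unfold F, dF. auto_derive; [lra|]. unfold Rminus. field. lra.
      - apply (ex_derive_continuous dF). unfold dF. auto_derive. repeat split; try lra. nra. }
    apply Rle_trans with (RInt dF a b).
    + apply RInt_le; [lra| |now exists (minus (F b) (F a))|].
      * apply ex_RInt_pos; try lra. intros; now apply continuous_gamma_integrand.
      * intros t Ht. unfold gamma_integrand, dF.
        assert (H1t : 0 < 1 + t) by lra.
        pose proof (Rpower_le_exp (s + 1) (1 + t) ltac:(lra) H1t) as HB.
        replace (exp (1 + t)) with (exp 1 * / exp (- t)) in HB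
          by (rewrite exp_plus, exp_Ropp, Rinv_inv; reflexivity).
        assert (He : 0 < exp (- t)) by apply exp_pos.
        assert (HB' : Rpower (1 + t) (s + 1) * exp (- t) <= K).
        { unfold K. apply Rmult_le_reg_r with (/ exp (- t)); [now apply Rinv_0_lt_compat|].
          rewrite Rmult_assoc, Rinv_r by lra. lra. }
        assert (Hid : exp (s * (ln t - ln (1 + t))) * / (t * (1 + t))
                 = Rpower t (s - 1) * / Rpower (1 + t) (s + 1)).
        { unfold Rpower. rewrite <- exp_Ropp.
          replace (/ (t * (1 + t))) with (exp (- ln t) * exp (- ln (1 + t))).
          - rewrite <- !exp_plus. f_equal. ring.
          - rewrite !exp_Ropp, !exp_ln by lra. field. lra. }
        rewrite Hid.
        pose proof (Rpower_pos t (s - 1)). pose proof (Rpower_pos (1 + t) (s + 1)).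
        apply Rmult_le_reg_r with (Rpower (1 + t) (s + 1)); [assumption|].
        replace (K * (Rpower t (s - 1) * / Rpower (1 + t) (s + 1)) * Rpower (1 + t) (s + 1))
          with (Rpower t (s - 1) * K) by (field; lra).
        rewrite Rmult_assoc. apply Rmult_le_compat_l; lra.
    + rewrite (is_RInt_unique _ _ _ _ HF). unfold minus, plus, opp; simpl.
      assert (0 < K / s) by (apply Rdiv_lt_0_compat; lra).
      assert (exp (s * (ln b - ln (1 + b))) <= 1).
      { replace 1 with (exp 0) at 2 by apply exp_0. apply exp_mono.
        assert (ln b < ln (1 + b)) by (apply ln_increasing; lra). nra. }
      assert (0 < F a) by (apply Rmult_lt_0_compat; [assumption|apply exp_pos]).
      assert (F b <= K / s) by (unfold F; nra). lra.
Qed.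

Lemma is_RInt_gen_Gamma (s : R) : 0 < s ->
  is_RInt_gen (gamma_integrand s) (at_right 0) (Rbar_locally p_infty) (Gamma s).
Proof.
  intros Hs. apply (RInt_gen_correct (gamma_integrand s)). now apply ex_RInt_gen_gamma.
Qed.

(** * The functional equation of Gamma *)

Lemma Rpower_exp_lim_0 (s : R) : 0 < s ->
  filterlim (fun t => Rpower t s * exp (- t)) (at_right 0) (locally 0).
Proof.
  intros Hs P [eps HP].
  assert (Hd : 0 < Rpower eps (/ s)) by apply Rpower_pos.
  exists (mkposreal _ Hd). intros t Ht Ht0.
  apply HP. unfold ball in *; simpl in *; unfold AbsRing_ball, abs, minus, plus, opp in *; simpl in *.
  rewrite Ropp_0, Rplus_0_r in *.
  assert (t < Rpower eps (/ s)) by (apply Rabs_def2 in Ht; lra).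
  assert (Rpower t s < eps).
  { destruct eps as [e He]; simpl in *.
    replace e with (Rpower (Rpower e (/ s)) s) at 1.
    - apply Rlt_Rpower_l; [assumption|lra].
    - rewrite Rpower_mult, Rinv_l, Rpower_1; lra. }
  assert (exp (- t) < 1) by (rewrite <- exp_0; apply exp_increasing; lra).
  pose proof (exp_pos (- t)). pose proof (Rpower_pos t s).
  rewrite Rabs_pos_eq; nra.
Qed.

Lemma Rpower_exp_lim_infty (s : R) : 0 < s ->
  filterlim (fun t => Rpower t s * exp (- t)) (Rbar_locally p_infty) (locally 0).
Proof.
  intros Hs P [eps HP].
  (* Exponent [s + 1] instead of [s] leaves one spare power of [t]: [t^s e^{-t} <= K / t]. *)
  set (K := exp ((s + 1) * ln (s + 1) - (s + 1))).
  assert (HK : 0 < K) by apply exp_pos.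
  assert (He := cond_pos eps).
  exists (K / eps). intros t Ht.
  assert (0 < K / eps) by (apply Rdiv_lt_0_compat; lra).
  assert (Ht0 : 0 < t) by lra.
  apply HP. unfold ball; simpl; unfold AbsRing_ball, abs, minus, plus, opp; simpl.
  rewrite Ropp_0, Rplus_0_r.
  pose proof (Rpower_le_exp (s + 1) t ltac:(lra) Ht0) as HB. fold K in HB.
  rewrite Rpower_plus, Rpower_1 in HB by lra.
  pose proof (exp_pos (- t)). pose proof (Rpower_pos t s).
  rewrite Rabs_pos_eq by nra.
  assert (HB' : Rpower t s * exp (- t) * t <= K).
  { apply Rmult_le_reg_r with (exp t); [apply exp_pos|].
    replace (Rpower t s * exp (- t) * t * exp t)
      with (Rpower t s * t * (exp (- t) * exp t)) by ring.
    rewrite <- exp_plus, Rplus_opp_l, exp_0. lra. }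
  apply Rmult_lt_reg_r with t; [lra|].
  apply Rle_lt_trans with (1 := HB').
  replace K with (K / eps * eps) by (field; lra). rewrite (Rmult_comm eps).
  apply Rmult_lt_compat_r; lra.
Qed.

(** The derivative of [t^s e^{-t}] is [s] times one integrand minus the other, and [t^s e^{-t}]
    tends to 0 at both ends. *)
Lemma Gamma_succ (s : R) : 0 < s -> Gamma (s + 1) = s * Gamma s.
Proof.
  intros Hs.
  set (F := fun t => Rpower t s * exp (- t)).
  assert (HD : forall t, 0 < t -> is_derive F t (s * gamma_integrand s t - gamma_integrand (s + 1) t)).
  { intros t Ht. unfold F, gamma_integrand, Rpower. auto_derive; [lra|].
    replace (s + 1 - 1) with s by ring.
    replace ((s - 1) * ln t) with (s * ln t + - ln t) by ring.
    rewrite (exp_plus _ (- ln t)), (exp_Ropp (ln t)), (exp_ln t Ht). field. lra. }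
  assert (H : is_RInt_gen (Derive F) (at_right 0) (Rbar_locally p_infty) (0 - 0)).
  { apply is_RInt_gen_Derive.
    - apply filter_imp with (2 := filter_prod_pos_le). intros [a b] Hab x Hx; simpl in *.
      rewrite Rmin_left in Hx by lra. eexists. apply HD. lra.
    - apply filter_imp with (2 := filter_prod_pos_le). intros [a b] Hab x Hx; simpl in *.
      rewrite Rmin_left in Hx by lra.
      apply (continuous_ext_loc (Derive F) (fun t => s * gamma_integrand s t - gamma_integrand (s + 1) t)).
      + assert (Hx0 : 0 < x) by lra. generalize (open_gt 0 x Hx0). apply filter_imp.
        intros y Hy. symmetry. apply is_derive_unique, HD, Hy.
      + apply (ex_derive_continuous (fun t => s * gamma_integrand s t - gamma_integrand (s + 1) t)).
        unfold gamma_integrand, Rpower. auto_derive. lra.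
    - now apply Rpower_exp_lim_0.
    - now apply Rpower_exp_lim_infty. }
  pose proof (is_RInt_gen_minus _ _ _ _
    (is_RInt_gen_scal _ s _ (is_RInt_gen_Gamma s Hs))
    (is_RInt_gen_Gamma (s + 1) ltac:(lra))) as H2.
  assert (H3 : is_RInt_gen (Derive F) (at_right 0) (Rbar_locally p_infty)
     (minus (scal s (Gamma s)) (Gamma (s + 1)))).
  { revert H2. apply is_RInt_gen_ext.
    apply filter_imp with (2 := filter_prod_pos_le). intros [a b] Hab x Hx; simpl in *.
    rewrite Rmin_left in Hx by lra. symmetry. apply is_derive_unique, HD. lra. }
  apply (is_RInt_gen_unique (V := R_CompleteNormedModule)) in H, H3.
  rewrite H in H3. unfold minus, plus, opp, scal in H3; simpl in H3; unfold mult in H3; simpl in H3. lra.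
Qed.

Lemma Gamma_1 : Gamma 1 = 1.
Proof.
  set (F := fun t => - exp (- t)).
  assert (HD : forall t, is_derive F t (exp (- t))).
  { intros t. unfold F. auto_derive; trivial. ring. }
  assert (H : is_RInt_gen (Derive F) (at_right 0) (Rbar_locally p_infty) (0 - - 1)).
  { apply is_RInt_gen_Derive.
    - apply filter_forall. intros [a b] x Hx. eexists. apply HD.
    - apply filter_forall. intros [a b] x Hx.
      apply (continuous_ext (fun t => exp (- t))).
      + intros t. symmetry. apply is_derive_unique, HD.
      + apply (ex_derive_continuous (fun t => exp (- t))). auto_derive. trivial.
    - replace (- 1) with (F 0) by (unfold F; rewrite Ropp_0, exp_0; reflexivity).
      apply filterlim_filter_le_1 with (2 := ex_derive_continuous F 0 (ex_intro _ _ (HD 0))).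
      intros P [e HP]. exists e. intros y Hy _. now apply HP.
    - assert (HL : is_lim (fun t => - exp (- t)) p_infty (- 0)).
      { apply (is_lim_opp (fun t => exp (- t)) p_infty 0).
        apply (is_lim_comp exp Ropp p_infty 0 m_infty).
        - apply is_lim_exp_m.
        - apply (is_lim_opp (fun t => t) p_infty p_infty). apply is_lim_id.
        - exists 0. intros; discriminate. }
      rewrite Ropp_0 in HL. exact HL. }
  apply (is_RInt_gen_unique (V := R_CompleteNormedModule)) in H.
  assert (H3 : RInt_gen (Derive F) (at_right 0) (Rbar_locally p_infty) = Gamma 1).
  { symmetry. apply (RInt_gen_ext (gamma_integrand 1) (Derive F)).
    - apply filter_imp with (2 := filter_prod_pos_le). intros [a b] Hab x Hx; simpl in *.
      rewrite Rmin_left in Hx by lra. rewrite (is_derive_unique _ _ _ (HD x)).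
      unfold gamma_integrand. replace (1 - 1) with 0 by ring. rewrite Rpower_O; lra.
    - apply ex_RInt_gen_gamma. lra. }
  lra.
Qed.

(** The tangent is taken at [t = x], the expectation of [t] under the density proportional to
    [t^(x-1) e^{-t}], so that its linear term integrates to exactly the value at the point of
    contact. *)
Lemma Gamma_add_le (x th : R) : 0 < x -> 0 <= th <= 1 ->
  Gamma (x + th) <= Rpower x th * Gamma x.
Proof.
  intros Hx Hth.
  set (c := Rpower x th).
  assert (H : is_RInt_gen (fun t => c * (1 - th) * gamma_integrand x t
                + c * th / x * gamma_integrand (x + 1) t)
     (at_right 0) (Rbar_locally p_infty)
     (c * (1 - th) * Gamma x + c * th / x * Gamma (x + 1))).
  { apply (is_RInt_gen_plus (fun t => c * (1 - th) * gamma_integrand x t)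
      (fun t => c * th / x * gamma_integrand (x + 1) t)).
    - apply (is_RInt_gen_scal (gamma_integrand x)). now apply is_RInt_gen_Gamma.
    - apply (is_RInt_gen_scal (gamma_integrand (x + 1))). apply is_RInt_gen_Gamma; lra. }
  apply (is_RInt_gen_le (gamma_integrand (x + th)) _ (Gamma (x + th))) in H.
  - rewrite Gamma_succ in H by assumption.
    replace (c * Gamma x) with (c * (1 - th) * Gamma x + c * th / x * (x * Gamma x)) by (field; lra).
    exact H.
  - intros t Ht. unfold gamma_integrand.
    replace (x + th - 1) with (x - 1 + th) by ring.
    replace (x + 1 - 1) with (x - 1 + 1) by ring.
    rewrite !Rpower_plus, Rpower_1 by assumption.
    pose proof (Rpower_Bernoulli_le t x th Ht Hx Hth) as HB. fold c in HB.
    pose proof (exp_pos (- t)). pose proof (Rpower_pos t (x - 1)).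
    replace (c * (1 - th) * (Rpower t (x - 1) * exp (- t)) +
      c * th / x * (Rpower t (x - 1) * t * exp (- t)))
      with (Rpower t (x - 1) * exp (- t) * (c * (1 - th + th * (t / x)))) by (field; lra).
    replace (Rpower t (x - 1) * Rpower t th * exp (- t))
      with (Rpower t (x - 1) * exp (- t) * Rpower t th) by ring.
    apply Rmult_le_compat_l; [nra|exact HB].
  - apply is_RInt_gen_Gamma; lra.
Qed.

(** Under the density proportional to [t^x e^{-t}] the expectation of [1 / t] is [1 / x]; the
    tangent in [1 / t] at [t = x] therefore integrates without remainder. *)
Lemma Gamma_add_ge (x p : R) : 0 < x -> 0 <= p ->
  Rpower x p * Gamma (x + 1) <= Gamma (x + 1 + p).
Proof.
  intros Hx Hp.
  set (c := Rpower x p).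
  assert (H : is_RInt_gen (fun t => c * (1 + p) * gamma_integrand (x + 1) t
                - c * p * x * gamma_integrand x t)
     (at_right 0) (Rbar_locally p_infty)
     (c * (1 + p) * Gamma (x + 1) - c * p * x * Gamma x)).
  { apply (is_RInt_gen_minus (fun t => c * (1 + p) * gamma_integrand (x + 1) t)
      (fun t => c * p * x * gamma_integrand x t)).
    - apply (is_RInt_gen_scal (gamma_integrand (x + 1))). apply is_RInt_gen_Gamma; lra.
    - apply (is_RInt_gen_scal (gamma_integrand x)). now apply is_RInt_gen_Gamma. }
  apply (is_RInt_gen_le _ (gamma_integrand (x + 1 + p)) _ (Gamma (x + 1 + p))) in H.
  - rewrite Gamma_succ in H |- * by assumption. lra.
  - intros t Ht. unfold gamma_integrand.
    replace (x + 1 + p - 1) with (x - 1 + 1 + p) by ring.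
    replace (x + 1 - 1) with (x - 1 + 1) by ring.
    rewrite !Rpower_plus, Rpower_1 by assumption.
    pose proof (Rpower_tangent_ge t x p Ht Hx Hp) as HB. fold c in HB.
    pose proof (exp_pos (- t)). pose proof (Rpower_pos t (x - 1)).
    replace (c * (1 + p) * (Rpower t (x - 1) * t * exp (- t)) -
       c * p * x * (Rpower t (x - 1) * exp (- t)))
      with (Rpower t (x - 1) * t * exp (- t) * (c * (1 + p - p * (x / t)))) by (field; lra).
    replace (Rpower t (x - 1) * t * Rpower t p * exp (- t))
      with (Rpower t (x - 1) * t * exp (- t) * Rpower t p) by ring.
    apply Rmult_le_compat_l; [|exact HB]. apply Rmult_le_pos; nra.
  - apply is_RInt_gen_Gamma; lra.
Qed.

(** Comparing improper integrals yields only weak inequalities; strictness comes from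
    [Gamma (s + 2) >= Gamma 2 = 1] and the functional equation. *)
Lemma Gamma_pos (s : R) : 0 < s -> 0 < Gamma s.
Proof.
  intros Hs. pose proof (Gamma_add_ge 1 s ltac:(lra) ltac:(lra)) as H.
  rewrite (Gamma_succ 1), Gamma_1 in H by lra.
  replace (1 + 1 + s) with (s + 1 + 1) in H by ring.
  rewrite (Gamma_succ (s + 1)), (Gamma_succ s) in H by lra.
  pose proof (Rpower_pos 1 s).
  assert (0 < s * (s + 1)) by nra. nra.
Qed.

(** * Means of powers of [|1 - r e^{it}|^2] *)

(* [ring] and [field] need the equality to be on [R] itself, not on the carrier of an instance. *)
Ltac eq_R := match goal with |- @eq _ ?a ?b => change (@eq R a b) end.

Lemma ex_RInt_everywhere (f : R -> R) (a b : R) :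
  (forall t, continuous f t) -> ex_RInt f a b.
Proof. intros Hf. apply (ex_RInt_continuous f). intros; apply Hf. Qed.

Lemma RInt_of_is_RInt (f : R -> R) (a b l : R) : is_RInt f a b l -> RInt f a b = l.
Proof. exact (is_RInt_unique f a b l). Qed.

Lemma is_RInt_lin (f g : R -> R) (a b l m c d : R) :
  is_RInt f a b l -> is_RInt g a b m ->
  is_RInt (fun t => c * f t + d * g t) a b (c * l + d * m).
Proof.
  intros Hf Hg. apply (is_RInt_plus (fun t => c * f t) (fun t => d * g t)).
  - exact (is_RInt_scal f a b c l Hf).
  - exact (is_RInt_scal g a b d m Hg).
Qed.

Lemma two_PI_pos : 0 < 2 * PI.
Proof. pose proof PI_RGT_0. lra. Qed.

Lemma RInt_periodic_shift (g : R -> R) (c : R) :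
  (forall t, continuous g t) -> (forall t, g (t + 2 * PI) = g t) ->
  RInt g c (c + 2 * PI) = RInt g 0 (2 * PI).
Proof.
  intros Hc Hp.
  assert (E : RInt g (2 * PI) (c + 2 * PI) = RInt g 0 c).
  { pose proof (RInt_comp_lin g 1 (2 * PI) 0 c (ex_RInt_everywhere g _ _ Hc)) as H.
    replace (1 * 0 + 2 * PI) with (2 * PI) in H by ring.
    replace (1 * c + 2 * PI) with (c + 2 * PI) in H by ring.
    rewrite <- H. apply RInt_ext. intros x _.
    now rewrite Rmult_1_l, Hp, Rmult_1_l. }
  pose proof (RInt_Chasles g 0 c (c + 2 * PI) (ex_RInt_everywhere g _ _ Hc) (ex_RInt_everywhere g _ _ Hc)) as H1.
  pose proof (RInt_Chasles g 0 (2 * PI) (c + 2 * PI) (ex_RInt_everywhere g _ _ Hc) (ex_RInt_everywhere g _ _ Hc)) as H2.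
  unfold plus in H1, H2; simpl in H1, H2. lra.
Qed.

(* [circ r t = |1 - r e^{it}|^2] *)
Definition circ (r t : R) : R := 1 - 2 * r * cos t + r ^ 2.

Lemma circ_pos (r t : R) : -1 < r < 1 -> 0 < circ r t.
Proof.
  intros Hr. unfold circ. pose proof (COS_bound t).
  destruct (Rle_dec 0 r); nra.
Qed.

Lemma circ_periodic (r t : R) : circ r (t + 2 * PI) = circ r t.
Proof. unfold circ. now rewrite cos_plus, cos_2PI, sin_2PI, Rmult_1_r, Rmult_0_r, Rminus_0_r. Qed.

Lemma continuous_circ (r t : R) : continuous (circ r) t.
Proof.
  apply (ex_derive_continuous (circ r)). unfold circ. auto_derive. trivial.
Qed.

Lemma continuous_comp_circ (F : R -> R) (r t : R) :
  -1 < r < 1 -> (forall x, 0 < x -> continuous F x) -> continuous (fun t => F (circ r t)) t.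
Proof.
  intros Hr HF. apply (continuous_comp (circ r) F).
  - apply continuous_circ.
  - apply HF, circ_pos, Hr.
Qed.

(** * The Moebius substitution on the circle *)

Lemma cos_2_atan (u : R) : cos (2 * atan u) = (1 - u ^ 2) / (1 + u ^ 2).
Proof.
  assert (H : 0 < 1 + u ^ 2) by nra.
  assert (E : sqrt (1 + u²) * sqrt (1 + u²) = 1 + u ^ 2).
  { rewrite sqrt_sqrt; unfold Rsqr; nra. }
  assert (0 < sqrt (1 + u²)) by (apply sqrt_lt_R0; unfold Rsqr; nra).
  rewrite cos_2a, cos_atan, sin_atan, <- E. field. lra.
Qed.

Lemma sin_2_atan (u : R) : sin (2 * atan u) = 2 * u / (1 + u ^ 2).
Proof.
  assert (H : 0 < 1 + u ^ 2) by nra.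
  assert (E : sqrt (1 + u²) * sqrt (1 + u²) = 1 + u ^ 2).
  { rewrite sqrt_sqrt; unfold Rsqr; nra. }
  assert (0 < sqrt (1 + u²)) by (apply sqrt_lt_R0; unfold Rsqr; nra).
  rewrite sin_2a, cos_atan, sin_atan, <- E. field. lra.
Qed.

(* The argument of the disk automorphism [(r - e^{it}) / (1 - r e^{it})]. *)
Definition moebius_arg (r t : R) : R :=
  t + 2 * atan (r * sin t / (1 - r * cos t)) + PI.

Lemma one_sub_r_cos_pos (r t : R) : 0 <= r < 1 -> 0 < 1 - r * cos t.
Proof. intros Hr. pose proof (COS_bound t). nra. Qed.

(** The derivative is the classical Poisson kernel, the boundary Jacobian of the disk
    automorphism. *)
Lemma is_derive_moebius_arg (r t : R) : 0 <= r < 1 ->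
  is_derive (moebius_arg r) t ((1 - r ^ 2) / circ r t).
Proof.
  intros Hr. pose proof (one_sub_r_cos_pos r t Hr) as Hu.
  pose proof (circ_pos r t ltac:(lra)) as HD.
  unfold moebius_arg. auto_derive; [lra|].
  pose proof (sin2_cos2 t) as Hsc. unfold Rsqr in Hsc.
  assert (HD' : circ r t = (1 - r * cos t) ^ 2 + (r * sin t) ^ 2) by (unfold circ; nra).
  rewrite HD' in *.
  (* With [q = r sin t] one has [r^2 = (1 - u)^2 + q^2], and the claim becomes a rational identity
     in [u] and [q]. *)
  set (u := 1 - r * cos t) in *.
  assert (Hc : r * cos t = 1 - u) by (unfold u; ring).
  assert (Hrr : r ^ 2 = (1 - u) ^ 2 + (r * sin t) ^ 2) by nra.
  replace (1 + - (r * cos t)) with u by (unfold u; ring).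
  replace (r * (1 * cos t)) with (1 - u) by (rewrite <- Hc; ring).
  replace (- (r * (1 * - sin t))) with (r * sin t) by ring.
  rewrite Hrr. clear HD' Hrr. set (q := r * sin t) in *. clearbody u q. field.
  split; lra.
Qed.

(** For [phi (z) = (r - z) / (1 - r z)] one has [1 - r phi (z) = (1 - r^2) / (1 - r z)]; take
    squared moduli at [z = e^{it}]. *)
Lemma circ_moebius_arg (r t : R) : 0 <= r < 1 ->
  circ r (moebius_arg r t) = (1 - r ^ 2) ^ 2 / circ r t.
Proof.
  intros Hr. pose proof (one_sub_r_cos_pos r t Hr) as Hu.
  pose proof (circ_pos r t ltac:(lra)) as HD.
  unfold circ at 1, moebius_arg. rewrite neg_cos, cos_plus, cos_2_atan, sin_2_atan.
  pose proof (sin2_cos2 t) as Hsc. unfold Rsqr in Hsc.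
  assert (HD' : circ r t = (1 - r * cos t) ^ 2 + (r * sin t) ^ 2) by (unfold circ; nra).
  assert (Hs : sin t * sin t = 1 - cos t * cos t) by lra.
  assert (E1 : (1 - (r * sin t / (1 - r * cos t)) ^ 2) / (1 + (r * sin t / (1 - r * cos t)) ^ 2)
     = ((1 - r * cos t) ^ 2 - r ^ 2 * (sin t * sin t)) / circ r t).
  { rewrite HD'. field. split; [lra|]. nra. }
  assert (E2 : sin t * (2 * (r * sin t / (1 - r * cos t)) / (1 + (r * sin t / (1 - r * cos t)) ^ 2))
     = (sin t * sin t) * (2 * r * (1 - r * cos t)) / circ r t).
  { rewrite HD'. field. split; [lra|]. nra. }
  rewrite E1, E2, Hs. unfold circ. unfold circ in HD. field. lra.
Qed.

Lemma moebius_arg_ends (r : R) :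
  moebius_arg r 0 = PI /\ moebius_arg r (2 * PI) = PI + 2 * PI.
Proof.
  unfold moebius_arg. rewrite sin_0, sin_2PI. unfold Rdiv.
  rewrite !Rmult_0_r, !Rmult_0_l, atan_0. split; ring.
Qed.

Lemma RInt_circ_moebius (F : R -> R) (r : R) : 0 <= r < 1 ->
  (forall x, 0 < x -> continuous F x) ->
  RInt (fun t => F (circ r t)) 0 (2 * PI)
  = RInt (fun t => (1 - r ^ 2) / circ r t * F ((1 - r ^ 2) ^ 2 / circ r t)) 0 (2 * PI).
Proof.
  intros Hr HF.
  assert (Hc : forall t, continuous (fun t => F (circ r t)) t)
    by (intros t; apply continuous_comp_circ; [lra|assumption]).
  (* The substitution carries [[0, 2 PI]] onto [[PI, 3 PI]], so the period is moved there
     beforehand. *)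
  rewrite <- (RInt_periodic_shift (fun t => F (circ r t)) PI Hc)
    by (intros t; now rewrite circ_periodic).
  destruct (moebius_arg_ends r) as [E0 E1]. rewrite <- E1. rewrite <- E0 at 1.
  rewrite <- (RInt_comp (fun t => F (circ r t)) (moebius_arg r) (fun t => (1 - r ^ 2) / circ r t)).
  - apply RInt_ext. intros t _. rewrite circ_moebius_arg by assumption. reflexivity.
  - intros; apply Hc.
  - intros t _. split; [now apply is_derive_moebius_arg|].
    apply (continuous_comp_circ (fun x => (1 - r ^ 2) / x)); [lra|].
    intros x Hx. apply (ex_derive_continuous (fun x => (1 - r ^ 2) / x)). auto_derive. lra.
Qed.

Lemma continuous_Rpower (s x : R) : 0 < x -> continuous (fun x => Rpower x s) x.
Proof.
  intros Hx. apply (ex_derive_continuous (fun x => Rpower x s)).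
  unfold Rpower. auto_derive. exact Hx.
Qed.

Lemma Rpower_add_1 (x s : R) : 0 < x -> Rpower x (s + 1) = Rpower x s * x.
Proof. intros Hx. now rewrite Rpower_plus, Rpower_1. Qed.

Lemma Rpower_sub_1 (x s : R) : 0 < x -> Rpower x (s - 1) = Rpower x s / x.
Proof.
  intros Hx. replace (Rpower x s) with (Rpower x (s - 1 + 1)) by (f_equal; ring).
  rewrite Rpower_add_1 by assumption. field. lra.
Qed.

Lemma Rpower_m1 (x : R) : 0 < x -> Rpower x (-1) = / x.
Proof.
  intros Hx. replace (-1) with (0 - 1) by ring.
  rewrite Rpower_sub_1, Rpower_O by assumption. field. lra.
Qed.

Definition circ_mean (s r : R) : R := RInt (fun t => Rpower (circ r t) s) 0 (2 * PI).

Lemma ex_RInt_comp_circ (F : R -> R) (r a b : R) : -1 < r < 1 ->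
  (forall x, 0 < x -> continuous F x) -> ex_RInt (fun t => F (circ r t)) a b.
Proof.
  intros Hr HF. apply ex_RInt_everywhere. intros t. now apply continuous_comp_circ.
Qed.

Lemma ex_RInt_circ (s r a b : R) : -1 < r < 1 ->
  ex_RInt (fun t => Rpower (circ r t) s) a b.
Proof.
  intros Hr. apply (ex_RInt_comp_circ (fun x => Rpower x s)); [assumption|].
  intros; now apply continuous_Rpower.
Qed.

Lemma is_RInt_circ (s r : R) : -1 < r < 1 ->
  is_RInt (fun t => Rpower (circ r t) s) 0 (2 * PI) (circ_mean s r).
Proof. intros Hr. apply (RInt_correct (fun t => Rpower (circ r t) s)). now apply ex_RInt_circ. Qed.

Lemma circ_mean_ge_0 (s r : R) : -1 < r < 1 -> 0 <= circ_mean s r.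
Proof.
  intros Hr. apply RInt_ge_0.
  - left; apply two_PI_pos.
  - now apply ex_RInt_circ.
  - intros; left; apply Rpower_pos.
Qed.

(* The left-hand integrand is [|P_alpha (r e^{it})|] for [alpha = 2 s]. *)
Lemma RInt_kernel_circ (s r : R) : 0 <= r < 1 ->
  RInt (fun t => Rpower (1 - r ^ 2) (2 * s + 1) * Rpower (circ r t) (- s - 1)) 0 (2 * PI)
  = circ_mean s r.
Proof.
  intros Hr. unfold circ_mean.
  rewrite (RInt_circ_moebius (fun x => Rpower x s) r Hr)
    by (intros; now apply continuous_Rpower).
  apply RInt_ext. intros t _. pose proof (circ_pos r t ltac:(lra)) as HD.
  assert (Hw : 0 < 1 - r ^ 2) by nra.
  set (w := 1 - r ^ 2) in *. set (D := circ r t) in *.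
  unfold Rdiv. rewrite <- Rpower_mult_distr by (try apply Rinv_0_lt_compat; nra).
  replace (/ D) with (Rpower D (- 1)) at 1 2 by (now apply Rpower_m1).
  replace (w ^ 2) with (Rpower w 2) by (rewrite <- (Rpower_pow 2 w Hw); f_equal; simpl; ring).
  replace (2 * s + 1) with (1 + 2 * s) by ring. replace (- s - 1) with (- 1 + (- 1) * s) by ring.
  rewrite !Rpower_plus, !Rpower_mult, Rpower_1 by assumption. eq_R. ring.
Qed.

(* Averaging the integrand with its Moebius image [D -> w^2/D], [w = 1 - r^2],
   gives [(D - w) D^{-s-1} (D^{2s} - w^{2s}) / 2], which has the sign of [s]. *)
Lemma circ_mean_sub_sign (s r : R) : 0 <= r < 1 ->
  0 <= s * RInt (fun t => (circ r t - (1 - r ^ 2)) * Rpower (circ r t) (s - 1)) 0 (2 * PI).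
Proof.
  intros Hr.
  assert (Hw : 0 < 1 - r ^ 2) by nra.
  set (w := 1 - r ^ 2) in *.
  set (F := fun x => (x - w) * Rpower x (s - 1)).
  assert (HF : forall x, 0 < x -> continuous F x).
  { intros x Hx. apply (ex_derive_continuous F). unfold F, Rpower. auto_derive. exact Hx. }
  set (H := fun x => w / x * F (w ^ 2 / x)).
  assert (HH : forall x, 0 < x -> continuous H x).
  { intros x Hx. apply (ex_derive_continuous H). unfold H, F, Rpower. auto_derive.
    repeat split; try lra. apply Rdiv_lt_0_compat; nra. }
  pose proof (RInt_circ_moebius F r Hr HF) as E. fold w in E.
  change (RInt (fun t => (circ r t - w) * Rpower (circ r t) (s - 1)) 0 (2 * PI))
    with (RInt (fun t => F (circ r t)) 0 (2 * PI)).
  assert (E2 : RInt (fun t => F (circ r t)) 0 (2 * PI)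
     = / 2 * RInt (fun t => F (circ r t) + H (circ r t)) 0 (2 * PI)).
  { rewrite (RInt_plus (fun t => F (circ r t)) (fun t => H (circ r t)))
      by (apply ex_RInt_comp_circ; try lra; assumption).
    unfold plus; simpl. unfold H at 1. rewrite <- E. lra. }
  rewrite E2.
  replace (s * (/ 2 * RInt (fun t => F (circ r t) + H (circ r t)) 0 (2 * PI)))
    with (RInt (fun t => (s / 2) * (F (circ r t) + H (circ r t))) 0 (2 * PI)).
  2:{ rewrite (RInt_scal (fun t => F (circ r t) + H (circ r t))).
      - unfold scal; simpl; unfold mult; simpl. eq_R. field.
      - apply (ex_RInt_plus (fun t => F (circ r t)) (fun t => H (circ r t)));
        apply ex_RInt_comp_circ; try lra; assumption. }
  apply RInt_ge_0.
  - left; apply two_PI_pos.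
  - apply (ex_RInt_scal (fun t => F (circ r t) + H (circ r t))).
    apply (ex_RInt_plus (fun t => F (circ r t)) (fun t => H (circ r t)));
      apply ex_RInt_comp_circ; try lra; assumption.
  - intros t _. pose proof (circ_pos r t ltac:(lra)) as HD.
    set (D := circ r t) in *.
    assert (EF : F D = (D - w) * (Rpower D (- s - 1) * Rpower D (2 * s))).
    { unfold F. rewrite <- Rpower_plus. f_equal. f_equal. ring. }
    assert (EH : H D = - (D - w) * (Rpower D (- s - 1) * Rpower w (2 * s))).
    { unfold H, F. unfold Rdiv at 3. rewrite <- Rpower_mult_distr by (try apply Rinv_0_lt_compat; nra).
      replace (Rpower (/ D) (s - 1)) with (Rpower D (- s - 1 + 1 + 1)).
      - replace (Rpower (w ^ 2) (s - 1)) with (Rpower w (2 * s - 1 - 1)).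
        + rewrite !Rpower_add_1, !Rpower_sub_1 by assumption. field. lra.
        + rewrite <- (Rpower_pow 2 w Hw), Rpower_mult. f_equal. simpl. ring.
      - replace (/ D) with (Rpower D (- 1)) by (now apply Rpower_m1).
        rewrite Rpower_mult. f_equal. ring. }
    rewrite EF, EH.
    replace (s / 2 * ((D - w) * (Rpower D (- s - 1) * Rpower D (2 * s)) +
       - (D - w) * (Rpower D (- s - 1) * Rpower w (2 * s))))
      with (Rpower D (- s - 1) / 2 * (s * ((D - w) * (Rpower D (2 * s) - Rpower w (2 * s))))) by field.
    pose proof (Rpower_pos D (- s - 1)).
    apply Rmult_le_pos; [lra|].
    (* For [s < 0] the power decreases in its base; the reciprocal reduces this to a positive
       exponent. *)
    assert (Hinv : forall x, Rpower x (2 * s) = / Rpower x (2 * - s)).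
    { intros x. rewrite <- Rpower_Ropp. f_equal. ring. }
    pose proof (Rpower_pos w (2 * - s)). pose proof (Rpower_pos D (2 * - s)).
    destruct (Rle_dec 0 s) as [Hs|Hs]; destruct (Rle_dec w D) as [HwD|HwD].
    + assert (Rpower w (2 * s) <= Rpower D (2 * s)) by (apply Rle_Rpower_l; lra).
      apply Rmult_le_pos; [lra|apply Rmult_le_pos; lra].
    + assert (Rpower D (2 * s) <= Rpower w (2 * s)) by (apply Rle_Rpower_l; lra).
      apply Rmult_le_pos; [lra|]. nra.
    + assert (Rpower D (2 * s) <= Rpower w (2 * s)).
      { rewrite !Hinv. apply Rinv_le_contravar; [assumption|]. apply Rle_Rpower_l; lra. }
      assert (0 <= (D - w) * (Rpower w (2 * s) - Rpower D (2 * s))) by (apply Rmult_le_pos; lra).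
      nra.
    + assert (Rpower w (2 * s) <= Rpower D (2 * s)).
      { rewrite !Hinv. apply Rinv_le_contravar; [assumption|]. apply Rle_Rpower_l; lra. }
      assert (0 <= (w - D) * (Rpower D (2 * s) - Rpower w (2 * s))) by (apply Rmult_le_pos; lra).
      nra.
Qed.

(** Serves to absorb the term with exponent [s - 1] of the three-term recurrence when its
    coefficient is positive. *)
Lemma circ_mean_sub_1_le (s r : R) : 0 < s -> 0 <= r < 1 ->
  (1 - r ^ 2) * circ_mean (s - 1) r <= circ_mean s r.
Proof.
  intros Hs Hr. pose proof (circ_mean_sub_sign s r Hr) as H.
  pose proof (is_RInt_lin _ _ _ _ _ _ 1 (- (1 - r ^ 2))
    (is_RInt_circ s r ltac:(lra)) (is_RInt_circ (s - 1) r ltac:(lra))) as H1.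
  apply RInt_of_is_RInt in H1; cbv beta in H1.
  rewrite (RInt_ext _ (fun t => 1 * Rpower (circ r t) s + - (1 - r ^ 2) * Rpower (circ r t) (s - 1))) in H.
  - rewrite H1 in H. nra.
  - intros t _. pose proof (circ_pos r t ltac:(lra)) as HD.
    rewrite Rpower_sub_1 by assumption. eq_R. field. lra.
Qed.

(** * Dependence of the means on the radius, and their recurrence *)

Lemma continuity_2d_pt_comp1 (f : R -> R) (g : R -> R -> R) (x y : R) :
  continuous f (g x y) -> continuity_2d_pt g x y ->
  continuity_2d_pt (fun u v => f (g u v)) x y.
Proof.
  intros Hf Hg. apply continuity_1d_2d_pt_comp; [|exact Hg].
  now apply continuity_pt_filterlim.
Qed.

Ltac continuity_2d :=
  repeat first
    [ assumption
    | match goal with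
      | |- continuity_2d_pt (fun u v => exp (@?g u v)) _ _ =>
          apply (continuity_2d_pt_comp1 exp g); [apply continuous_exp|]
      | |- continuity_2d_pt (fun u v => cos (@?g u v)) _ _ =>
          apply (continuity_2d_pt_comp1 cos g); [apply continuous_cos|]
      | |- continuity_2d_pt (fun u v => sin (@?g u v)) _ _ =>
          apply (continuity_2d_pt_comp1 sin g); [apply continuous_sin|]
      | |- continuity_2d_pt (fun u v => atan (@?g u v)) _ _ =>
          apply (continuity_2d_pt_comp1 atan g); [apply continuous_atan|]
      | |- continuity_2d_pt (fun u v => ln (@?g u v)) _ _ =>
          apply (continuity_2d_pt_comp1 ln g); [apply continuous_ln|]
      | |- continuity_2d_pt (fun u v => / (@?g u v)) _ _ =>
          apply (continuity_2d_pt_inv g)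
      end
    | apply continuity_2d_pt_const | apply continuity_2d_pt_id1 | apply continuity_2d_pt_id2
    | apply continuity_2d_pt_opp | apply continuity_2d_pt_plus | apply continuity_2d_pt_minus
    | apply continuity_2d_pt_mult ].

Lemma is_derive_circ_mean (s r : R) : 0 <= r < 1 ->
  is_derive (circ_mean s) r
    (RInt (fun t => s * (2 * r - 2 * cos t) * Rpower (circ r t) (s - 1)) 0 (2 * PI)).
Proof.
  intros Hr.
  assert (HD : forall u t, -1 < u < 1 ->
    is_derive (fun z => Rpower (circ z t) s) u (s * (2 * u - 2 * cos t) * Rpower (circ u t) (s - 1))).
  { intros u t Hu. pose proof (circ_pos u t Hu) as H. rewrite Rpower_sub_1 by assumption.
    unfold Rpower, circ in *. auto_derive; [lra|].
    unfold Rminus. simpl. field. simpl in H. lra. }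
  assert (Hloc : locally r (fun u => -1 < u < 1)).
  { apply (open_and _ _ (open_gt (-1)) (open_lt 1)). lra. }
  rewrite (RInt_ext _ (fun t => Derive (fun u => Rpower (circ u t) s) r))
    by (intros t _; symmetry; apply is_derive_unique, HD; lra).
  apply (is_derive_RInt_param (fun u t => Rpower (circ u t) s)).
  - revert Hloc. apply filter_imp. intros u Hu t _. eexists. now apply HD.
  - intros t _.
    apply (continuity_2d_pt_ext_loc (fun u v => s * (2 * u - 2 * cos v) * Rpower (circ u v) (s - 1))).
    + destruct Hloc as [e He]. exists e. intros u v Hu _. symmetry. apply is_derive_unique, HD, He, Hu.
    + assert (Hcos : continuity_2d_pt (fun _ v => cos v) r t).
      { apply (continuity_2d_pt_comp1 cos (fun _ v => v)); [apply continuous_cos|apply continuity_2d_pt_id2]. }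
      assert (continuity_2d_pt circ r t).
      { unfold circ. simpl. continuity_2d. }
      assert (continuity_2d_pt (fun u v => Rpower (circ u v) (s - 1)) r t).
      { apply (continuity_2d_pt_comp1 (fun x => Rpower x (s - 1)) circ); [|assumption].
        apply continuous_Rpower, circ_pos. lra. }
      continuity_2d.
  - revert Hloc. apply filter_imp. intros u Hu. now apply ex_RInt_circ.
Qed.

(** Since [c (2 c - 2 cos t) = circ c t - (1 - c^2)], the derivative at [c] is [1 / c] times the
    quantity of [circ_mean_sub_sign]. The mean value point lies strictly above [r >= 0], so dividing
    by [c] is legitimate. *)
Lemma circ_mean_increasing (s r r' : R) : 0 <= r <= r' -> r' < 1 ->
  circ_mean s r <= circ_mean s r'.
Proof.
  intros [Hr [Hlt| ->]] Hr'; [|lra].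
  destruct (MVT_cor2 (circ_mean s)
    (fun r => RInt (fun t => s * (2 * r - 2 * cos t) * Rpower (circ r t) (s - 1)) 0 (2 * PI))
    r r' Hlt) as [c [Ec Hc]].
  { intros c Hc. apply is_derive_Reals, is_derive_circ_mean. lra. }
  pose proof (circ_mean_sub_sign s c ltac:(lra)) as Hsgn.
  assert (Hex : ex_RInt (fun t => (circ c t - (1 - c ^ 2)) * Rpower (circ c t) (s - 1)) 0 (2 * PI)).
  { apply (ex_RInt_comp_circ (fun x => (x - (1 - c ^ 2)) * Rpower x (s - 1))); [lra|].
    intros x Hx. apply (ex_derive_continuous (fun x => (x - (1 - c ^ 2)) * Rpower x (s - 1))).
    unfold Rpower. auto_derive. exact Hx. }
  assert (E : s / c * RInt (fun t => (circ c t - (1 - c ^ 2)) * Rpower (circ c t) (s - 1)) 0 (2 * PI)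
    = RInt (fun t => s * (2 * c - 2 * cos t) * Rpower (circ c t) (s - 1)) 0 (2 * PI)).
  { symmetry. apply RInt_of_is_RInt.
    apply (is_RInt_ext (fun t => (s / c) * ((circ c t - (1 - c ^ 2)) * Rpower (circ c t) (s - 1)))).
    - intros t _. unfold circ. eq_R. field. lra.
    - exact (is_RInt_scal _ _ _ (s / c) _ (RInt_correct _ _ _ Hex)). }
  rewrite <- E in Ec.
  replace (s / c * RInt (fun t => (circ c t - (1 - c ^ 2)) * Rpower (circ c t) (s - 1)) 0 (2 * PI))
    with (/ c * (s * RInt (fun t => (circ c t - (1 - c ^ 2)) * Rpower (circ c t) (s - 1)) 0 (2 * PI)))
    in Ec by (field; lra).
  assert (0 < / c) by (apply Rinv_0_lt_compat; lra).
  assert (0 <= / c * (s * RInt (fun t => (circ c t - (1 - c ^ 2)) * Rpower (circ c t) (s - 1)) 0 (2 * PI)) * (r' - r)).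
  { apply Rmult_le_pos; [apply Rmult_le_pos|]; lra. }
  lra.
Qed.

(* Integrates [2 r d/dt (sin t * D^s)] over a period. *)
Lemma circ_mean_recurrence (s r : R) : 0 <= r < 1 ->
  (2 * s + 1) * (1 + r ^ 2) * circ_mean s r
  = (s + 1) * circ_mean (s + 1) r + s * (1 - r ^ 2) ^ 2 * circ_mean (s - 1) r.
Proof.
  intros Hr.
  set (F := fun t => 2 * r * sin t * Rpower (circ r t) s).
  set (G := fun x => 1 * ((2 * s + 1) * (1 + r ^ 2) * Rpower x s + - (s + 1) * Rpower x (s + 1))
     + - (s * (1 - r ^ 2) ^ 2) * Rpower x (s - 1)).
  assert (HD : forall t, is_derive F t (G (circ r t))).
  { intros t. pose proof (circ_pos r t ltac:(lra)) as HD. unfold F, G.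
    rewrite Rpower_add_1, Rpower_sub_1 by assumption.
    pose proof (sin2_cos2 t) as Hsc. unfold Rsqr in Hsc.
    assert (Hd : is_derive (circ r) t (2 * r * sin t)).
    { unfold circ. auto_derive; trivial. ring. }
    assert (Hp : is_derive (fun t => Rpower (circ r t) s) t
                   (2 * r * sin t * (s * (Rpower (circ r t) s / circ r t)))).
    { apply (is_derive_comp (fun x => Rpower x s) (circ r)); [|exact Hd].
      unfold Rpower. auto_derive; [exact HD|]. field. lra. }
    assert (Hs : is_derive (fun t => 2 * r * sin t) t (2 * r * cos t))
      by (auto_derive; trivial; ring).
    evar_last; [apply (is_derive_mult (fun t => 2 * r * sin t) (fun t => Rpower (circ r t) s) t _ _ Hs Hp);
      intros; apply Rmult_comm|].
    unfold plus, mult; simpl.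
    set (p := Rpower (circ r t) s). set (D := circ r t) in *.
    (* Sine and cosine are eliminated in favour of [D]; the identity
       [4 r^2 - (1 + r^2)^2 = - (1 - r^2)^2] produces the coefficient that degenerates as
       [r -> 1]. *)
    assert (E : 4 * r * r * (sin t * sin t) = 4 * r ^ 2 - (1 + r ^ 2 - D) ^ 2).
    { unfold D, circ. replace (sin t * sin t) with (1 - cos t * cos t) by lra. ring. }
    assert (Ec : 2 * r * cos t = 1 + r ^ 2 - D) by (unfold D, circ; ring).
    replace (2 * r * cos t * p + 2 * r * sin t * (2 * r * sin t * (s * (p / D))))
      with ((2 * r * cos t) * p + s * (4 * r * r * (sin t * sin t)) / D * p) by (field; lra).
    rewrite E, Ec. field. lra. }
  assert (HI : is_RInt (fun t => G (circ r t)) 0 (2 * PI) (minus (F (2 * PI)) (F 0))).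
  { apply (is_RInt_derive F); intros t _; [apply HD|].
    apply (continuous_comp_circ G); [lra|].
    intros x Hx. apply (ex_derive_continuous G). unfold G, Rpower. auto_derive. auto. }
  pose proof (is_RInt_lin _ _ _ _ _ _ 1 (- (s * (1 - r ^ 2) ^ 2))
    (is_RInt_lin _ _ _ _ _ _ ((2 * s + 1) * (1 + r ^ 2)) (- (s + 1))
      (is_RInt_circ s r ltac:(lra)) (is_RInt_circ (s + 1) r ltac:(lra)))
    (is_RInt_circ (s - 1) r ltac:(lra))) as H1.
  apply RInt_of_is_RInt in HI. apply RInt_of_is_RInt in H1; cbv beta in H1.
  unfold G in HI. rewrite HI in H1. unfold F in H1. rewrite sin_0, sin_2PI in H1.
  unfold minus, plus, opp in H1; simpl in H1. simpl. lra.
Qed.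

(** * Bounding the means by Gamma quotients *)

(** The central binomial coefficient [binom (2 s) s] continued to real [s]. *)
Definition gamma_ratio (s : R) : R := Gamma (2 * s + 1) / Gamma (s + 1) ^ 2.

Lemma gamma_ratio_pos (s : R) : - / 2 < s -> 0 < gamma_ratio s.
Proof.
  intros Hs. apply Rdiv_lt_0_compat; [|apply pow_lt]; apply Gamma_pos; lra.
Qed.

Lemma gamma_ratio_succ (s : R) : - / 2 < s ->
  (s + 1) * gamma_ratio (s + 1) = 2 * (2 * s + 1) * gamma_ratio s.
Proof.
  intros Hs. unfold gamma_ratio.
  replace (2 * (s + 1) + 1) with (2 * s + 1 + 1 + 1) by ring.
  rewrite (Gamma_succ (2 * s + 1 + 1)), (Gamma_succ (2 * s + 1)), (Gamma_succ (s + 1)) by lra.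
  pose proof (Gamma_pos (s + 1) ltac:(lra)). field. lra.
Qed.

Lemma gamma_ratio_0 : gamma_ratio 0 = 1.
Proof.
  unfold gamma_ratio. rewrite Rmult_0_r, Rplus_0_l, Gamma_1. field.
Qed.

(** Stands in for the passage to the limit [h -> 0], with [h] the distance from the radius to 1. *)
Lemma le_of_le_add_small (h0 X Y Z : R) : 0 < h0 ->
  (forall h, 0 < h <= h0 -> X - h * Y <= Z) -> X <= Z.
Proof.
  intros Hh0 H. apply Rnot_lt_le. intros Hlt.
  assert (HY : 0 < Rabs Y + 1) by (pose proof (Rabs_pos Y); lra).
  set (h := Rmin h0 ((X - Z) / 2 / (Rabs Y + 1))).
  assert (Hd : 0 < (X - Z) / 2 / (Rabs Y + 1)) by (repeat apply Rdiv_lt_0_compat; lra).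
  assert (Hh : 0 < h <= h0) by (split; [now apply Rmin_glb_lt|apply Rmin_l]).
  specialize (H h Hh).
  assert (h * (Rabs Y + 1) <= (X - Z) / 2).
  { replace ((X - Z) / 2) with ((X - Z) / 2 / (Rabs Y + 1) * (Rabs Y + 1)) by (field; lra).
    apply Rmult_le_compat_r; [lra|apply Rmin_r]. }
  pose proof (Rle_abs Y). nra.
Qed.

(** The recurrence is evaluated near radius 1, where it loses its third term; monotonicity brings
    the bound back to the given [r]. *)
Lemma circ_mean_descent (s B : R) : - / 2 < s ->
  (forall r, 0 <= r < 1 -> circ_mean (s + 1) r <= B) ->
  forall r, 0 <= r < 1 -> 2 * (2 * s + 1) * circ_mean s r <= (s + 1) * B.
Proof.
  intros Hs HB r Hr.
  (* Replacing [1 + q^2] by 2 costs [(2 s + 1) (1 - q^2)]. For [s > 0] the last term of the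
     recurrence is at most [s (1 - q^2) circ_mean s q], hence [3 s + 1]; for [s <= 0] that term is
     nonpositive, and the added 1 ensures [1 <= C]. *)
  assert (HC : exists C, 1 <= C /\ forall q, 0 <= q < 1 ->
     (2 * (2 * s + 1) - C * (1 - q ^ 2)) * circ_mean s q <= (s + 1) * B).
  { destruct (Rle_dec s 0) as [Hs0|Hs0].
    - exists (2 * s + 1 + 1). split; [lra|]. intros q Hq.
      pose proof (circ_mean_recurrence s q Hq) as E. specialize (HB q Hq).
      pose proof (circ_mean_ge_0 (s - 1) q ltac:(lra)). pose proof (circ_mean_ge_0 s q ltac:(lra)).
      assert (s * (1 - q ^ 2) ^ 2 * circ_mean (s - 1) q <= 0).
      { assert (0 <= (1 - q ^ 2) ^ 2 * circ_mean (s - 1) q)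
          by (apply Rmult_le_pos; [apply pow2_ge_0|assumption]). nra. }
      assert (0 <= (1 - q ^ 2) * circ_mean s q) by (apply Rmult_le_pos; nra).
      nra.
    - exists (3 * s + 1). split; [lra|]. intros q Hq.
      pose proof (circ_mean_recurrence s q Hq) as E. specialize (HB q Hq).
      pose proof (circ_mean_sub_1_le s q ltac:(lra) Hq) as H1.
      assert (s * (1 - q ^ 2) ^ 2 * circ_mean (s - 1) q <= s * (1 - q ^ 2) * circ_mean s q).
      { replace (s * (1 - q ^ 2) ^ 2 * circ_mean (s - 1) q)
          with (s * (1 - q ^ 2) * ((1 - q ^ 2) * circ_mean (s - 1) q)) by ring.
        apply Rmult_le_compat_l; [apply Rmult_le_pos; nra|exact H1]. }
      nra. }
  destruct HC as [C [HC1 HC]].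
  (* The radius is [q = 1 - h], with [1 - q^2 <= 2 h]. The first bound on [h] gives [r <= 1 - h];
     the second keeps the coefficient of the mean nonnegative. *)
  apply (le_of_le_add_small (Rmin (1 - r) ((2 * s + 1) / C)) _ (2 * C * circ_mean s r)).
  - apply Rmin_glb_lt; [lra|apply Rdiv_lt_0_compat; lra].
  - intros h [Hh Hh0].
    pose proof (Rle_trans _ _ _ Hh0 (Rmin_l _ _)) as Hh1.
    pose proof (Rle_trans _ _ _ Hh0 (Rmin_r _ _)) as Hh2.
    assert (HhC : h * C <= 2 * s + 1).
    { replace (2 * s + 1) with ((2 * s + 1) / C * C) by (field; lra).
      apply Rmult_le_compat_r; lra. }
    pose proof (circ_mean_increasing s r (1 - h) ltac:(lra) ltac:(lra)) as Hinc.
    specialize (HC (1 - h) ltac:(lra)).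
    pose proof (circ_mean_ge_0 s r ltac:(lra)).
    apply Rle_trans with (2 := HC).
    replace (2 * (2 * s + 1) * circ_mean s r - h * (2 * C * circ_mean s r))
      with ((2 * (2 * s + 1) - 2 * (h * C)) * circ_mean s r) by ring.
    apply Rmult_le_compat; nra.
Qed.

(** The recurrence run upwards: for nonnegative exponents its last term may be dropped and [1 + r^2]
    replaced by 2, which leaves exactly the recurrence of [gamma_ratio]. *)
Lemma circ_mean_nat_le (m : nat) (r : R) : 0 <= r < 1 ->
  circ_mean (INR m) r <= 2 * PI * gamma_ratio (INR m).
Proof.
  intros Hr. induction m as [|m IH].
  - simpl INR. rewrite gamma_ratio_0. unfold circ_mean.
    rewrite (RInt_ext _ (fun _ => 1)).
    + rewrite RInt_const. apply Req_le. change ((2 * PI - 0) * 1 = 2 * PI * 1). ring.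
    + intros t _. now apply Rpower_O, circ_pos; lra.
  - rewrite S_INR. pose proof (pos_INR m) as Hm. set (x := INR m) in *.
    apply Rmult_le_reg_l with (x + 1); [lra|].
    replace ((x + 1) * (2 * PI * gamma_ratio (x + 1))) with (2 * PI * ((x + 1) * gamma_ratio (x + 1))) by ring.
    rewrite gamma_ratio_succ by lra.
    pose proof (circ_mean_recurrence x r Hr) as E.
    pose proof (circ_mean_ge_0 (x - 1) r ltac:(lra)). pose proof (circ_mean_ge_0 x r ltac:(lra)).
    assert (0 <= x * (1 - r ^ 2) ^ 2 * circ_mean (x - 1) r)
      by (repeat apply Rmult_le_pos; try assumption; try apply pow2_ge_0; nra).
    assert ((2 * x + 1) * (1 + r ^ 2) * circ_mean x r <= 2 * (2 * x + 1) * circ_mean x r).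
    { apply Rmult_le_compat_r; [assumption|]. assert (r ^ 2 <= 1) by nra. nra. }
    assert (2 * (2 * x + 1) * circ_mean x r <= 2 * (2 * x + 1) * (2 * PI * gamma_ratio x))
      by (apply Rmult_le_compat_l; lra).
    lra.
Qed.

(** The tangent is taken at 4, the supremum of [|1 - r e^{it}|^2], near which the mass concentrates
    for large exponents as [r -> 1]. Correspondingly [gamma_ratio] grows by at most a factor 4 per
    unit step. *)
Lemma circ_mean_interpolate (m : nat) (th r : R) : 0 <= th <= 1 -> 0 <= r < 1 ->
  circ_mean (INR m + th) r <= 2 * PI * (Rpower 4 th * gamma_ratio (INR m)).
Proof.
  intros Hth Hr. pose proof (pos_INR m) as Hm. set (x := INR m) in *.
  set (c := Rpower 4 th). assert (Hc : 0 < c) by apply Rpower_pos.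
  pose proof (is_RInt_lin _ _ _ _ _ _ (c * (1 - th)) (c * th / 4)
    (is_RInt_circ x r ltac:(lra)) (is_RInt_circ (x + 1) r ltac:(lra))) as H1.
  assert (H2 : circ_mean (x + th) r <= c * (1 - th) * circ_mean x r + c * th / 4 * circ_mean (x + 1) r).
  { rewrite <- (RInt_of_is_RInt _ _ _ _ H1). apply RInt_le.
    - left; apply two_PI_pos.
    - apply ex_RInt_circ; lra.
    - eexists; exact H1.
    - intros t _. pose proof (circ_pos r t ltac:(lra)) as HD.
      rewrite Rpower_add_1, Rpower_plus by assumption.
      pose proof (Rpower_Bernoulli_le (circ r t) 4 th HD ltac:(lra) Hth) as HB. fold c in HB.
      pose proof (Rpower_pos (circ r t) x).
      replace (c * (1 - th) * Rpower (circ r t) x + c * th / 4 * (Rpower (circ r t) x * circ r t))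
        with (Rpower (circ r t) x * (c * (1 - th + th * (circ r t / 4)))) by field.
      apply Rmult_le_compat_l; lra. }
  pose proof (circ_mean_nat_le m r Hr) as Hm0. pose proof (circ_mean_nat_le (S m) r Hr) as Hm1.
  rewrite S_INR in Hm1. fold x in Hm0, Hm1.
  pose proof (gamma_ratio_succ x ltac:(lra)) as Hg. pose proof (gamma_ratio_pos x ltac:(lra)) as Hg0.
  assert (Hg1 : gamma_ratio (x + 1) <= 4 * gamma_ratio x).
  { apply Rmult_le_reg_l with (x + 1); [lra|]. rewrite Hg. nra. }
  pose proof two_PI_pos as Hpi.
  apply Rle_trans with (1 := H2).
  apply Rle_trans with (c * (1 - th) * (2 * PI * gamma_ratio x) + c * th / 4 * (2 * PI * (4 * gamma_ratio x))).
  - apply Rplus_le_compat; apply Rmult_le_compat_l.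
    + apply Rmult_le_pos; lra.
    + exact Hm0.
    + apply Rmult_le_pos; [apply Rmult_le_pos; lra|lra].
    + apply Rle_trans with (1 := Hm1). apply Rmult_le_compat_l; lra.
  - right. field.
Qed.

(** Passing from [m] to [m + th] multiplies the numerator by at least [(2 m)^(2 th) = 4^th m^(2 th)]
    and the denominator by at most [(m + 1)^(2 th)]. The mismatch is at most [((m + 1) / m)^2],
    which tends to 1. *)
Lemma gamma_ratio_interpolate (m : nat) (th : R) : (1 <= m)%nat -> 0 <= th <= 1 ->
  Rpower 4 th * gamma_ratio (INR m) <= ((INR m + 1) / INR m) ^ 2 * gamma_ratio (INR m + th).
Proof.
  intros Hm Hth. apply le_INR in Hm. change (INR 1) with 1 in Hm. set (x := INR m) in *.
  unfold gamma_ratio.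
  pose proof (Gamma_add_ge (2 * x) (2 * th) ltac:(lra) ltac:(lra)) as H1.
  pose proof (Gamma_add_le (x + 1) th ltac:(lra) Hth) as H2.
  replace (2 * (x + th) + 1) with (2 * x + 1 + 2 * th) by ring.
  replace (x + th + 1) with (x + 1 + th) by ring.
  pose proof (Gamma_pos (2 * x + 1) ltac:(lra)). pose proof (Gamma_pos (x + 1) ltac:(lra)).
  pose proof (Gamma_pos (2 * x + 1 + 2 * th) ltac:(lra)) as HA. pose proof (Gamma_pos (x + 1 + th) ltac:(lra)) as HB.
  set (A := Gamma (2 * x + 1 + 2 * th)) in *. set (B := Gamma (x + 1 + th)) in *.
  set (a := Gamma (2 * x + 1)) in *. set (b := Gamma (x + 1)) in *.
  assert (Hx1 : 0 < Rpower (x + 1) th) by apply Rpower_pos.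
  assert (Hx2 : 0 < Rpower x th) by apply Rpower_pos.
  assert (Hq : Rpower (x + 1) th <= (x + 1) / x * Rpower x th).
  { replace (x + 1) with ((x + 1) / x * x) at 1 by (field; lra).
    assert (H1x : 1 <= (x + 1) / x).
    { apply Rmult_le_reg_r with x; [lra|]. unfold Rdiv. rewrite Rmult_assoc, Rinv_l; lra. }
    rewrite <- Rpower_mult_distr by lra. apply Rmult_le_compat_r; [lra|].
    rewrite <- (Rpower_1 ((x + 1) / x)) at 2 by lra.
    apply Rle_Rpower; lra. }
  assert (E : Rpower (2 * x) (2 * th) = Rpower 4 th * Rpower x th ^ 2).
  { replace (2 * th) with (th + th) by ring. rewrite Rpower_plus, <- Rpower_mult_distr by lra.
    replace 4 with (2 * 2) by ring. rewrite <- (Rpower_mult_distr 2 2) by lra. ring. }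
  rewrite E in H1.
  apply Rmult_le_reg_r with (B ^ 2 * b ^ 2); [apply Rmult_lt_0_compat; apply pow_lt; assumption|].
  replace (Rpower 4 th * (a / b ^ 2) * (B ^ 2 * b ^ 2)) with (Rpower 4 th * a * B ^ 2) by (field; lra).
  replace (((x + 1) / x) ^ 2 * (A / B ^ 2) * (B ^ 2 * b ^ 2))
    with (((x + 1) / x) ^ 2 * A * b ^ 2) by (field; lra).
  assert (HB2 : B ^ 2 <= ((x + 1) / x * Rpower x th * b) ^ 2).
  { apply pow_incr. split; [lra|]. apply Rle_trans with (1 := H2). apply Rmult_le_compat_r; lra. }
  apply Rle_trans with (Rpower 4 th * a * ((x + 1) / x * Rpower x th * b) ^ 2).
  - apply Rmult_le_compat_l; [|exact HB2]. pose proof (Rpower_pos 4 th). nra.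
  - replace (Rpower 4 th * a * ((x + 1) / x * Rpower x th * b) ^ 2)
      with (((x + 1) / x) ^ 2 * (Rpower 4 th * Rpower x th ^ 2 * a) * b ^ 2) by ring.
    apply Rmult_le_compat_r; [apply pow2_ge_0|].
    apply Rmult_le_compat_l; [apply pow2_ge_0|exact H1].
Qed.

(** [gamma_ratio] satisfies the limiting recurrence with equality, so [rho] is passed down
    unchanged. *)
Lemma circ_mean_le_step (rho s : R) : - / 2 < s ->
  (forall r, 0 <= r < 1 -> circ_mean (s + 1) r <= rho * gamma_ratio (s + 1)) ->
  forall r, 0 <= r < 1 -> circ_mean s r <= rho * gamma_ratio s.
Proof.
  intros Hs H r Hr. pose proof (circ_mean_descent s _ Hs H r Hr) as H1.
  replace ((s + 1) * (rho * gamma_ratio (s + 1))) with (rho * ((s + 1) * gamma_ratio (s + 1))) in H1 by ring.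
  rewrite gamma_ratio_succ in H1 by assumption.
  apply Rmult_le_reg_l with (2 * (2 * s + 1)); lra.
Qed.

Lemma circ_mean_le_steps (rho s : R) (n : nat) : - / 2 < s ->
  (forall r, 0 <= r < 1 -> circ_mean (s + INR n) r <= rho * gamma_ratio (s + INR n)) ->
  forall r, 0 <= r < 1 -> circ_mean s r <= rho * gamma_ratio s.
Proof.
  revert s. induction n as [|n IH]; intros s Hs H.
  - simpl INR in H. now rewrite Rplus_0_r in H.
  - apply circ_mean_le_step; [assumption|]. apply IH; [lra|].
    rewrite S_INR in H. now replace (s + 1 + INR n) with (s + (INR n + 1)) by ring.
Qed.

(** With [k] the integer part of [s], the number [s + n] has integer part [k + n]. The interpolation
    loss at that height survives the descent unchanged and vanishes as [n] grows. *)
Lemma circ_mean_le_of_ge_0 (s r : R) : 0 <= s -> 0 <= r < 1 ->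
  circ_mean s r <= 2 * PI * gamma_ratio s.
Proof.
  intros Hs Hr.
  destruct (nfloor_ex s Hs) as [k Hk].
  pose proof (gamma_ratio_pos s ltac:(lra)) as Hg. pose proof two_PI_pos as Hpi.
  assert (HJ : 0 < 2 * PI * gamma_ratio s) by (apply Rmult_lt_0_compat; assumption).
  set (J := 2 * PI * gamma_ratio s) in *.
  (* The 3 comes from [(1 + u)^2 <= 1 + 3 u] for [0 < u <= 1], applied to [u = 1 / m <= 1 / n]. *)
  assert (Hn : forall n : nat, (1 <= n)%nat -> circ_mean s r - / INR n * (3 * J) <= J).
  { intros n Hn.
    assert (HN : 1 <= INR n) by (apply le_INR in Hn; exact Hn).
    set (m := (k + n)%nat).
    assert (Hm : INR n <= INR m) by (apply le_INR; unfold m; lia).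
    set (x := INR m) in *.
    assert (H : circ_mean s r <= (2 * PI * ((x + 1) / x) ^ 2) * gamma_ratio s).
    { apply (circ_mean_le_steps _ _ n); [lra| |assumption]. intros q Hq.
      replace (s + INR n) with (x + (s - INR k)) by (unfold x, m; rewrite plus_INR; ring).
      apply Rle_trans with (1 := circ_mean_interpolate m (s - INR k) q ltac:(lra) Hq).
      rewrite (Rmult_assoc (2 * PI)). apply Rmult_le_compat_l; [lra|].
      apply gamma_ratio_interpolate; [unfold m; lia|lra]. }
    assert (Hx : ((x + 1) / x) ^ 2 <= 1 + 3 * / INR n).
    { replace ((x + 1) / x) with (1 + / x) by (field; lra).
      assert (0 < / x <= 1).
      { split; [apply Rinv_0_lt_compat; lra|]. rewrite <- Rinv_1. apply Rinv_le_contravar; lra. }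
      assert (/ x <= / INR n) by (apply Rinv_le_contravar; lra). nra. }
    replace (2 * PI * ((x + 1) / x) ^ 2 * gamma_ratio s) with (((x + 1) / x) ^ 2 * J) in H by (unfold J; ring).
    nra. }
  apply Rnot_lt_le. intros Hlt.
  set (d := (circ_mean s r - J) / (3 * J)).
  assert (Hd : 0 < d) by (apply Rdiv_lt_0_compat; lra).
  destruct (archimed_cor1 d Hd) as [n [Hn1 Hn0]].
  specialize (Hn n Hn0).
  assert (/ INR n * (3 * J) < d * (3 * J)) by (apply Rmult_lt_compat_r; lra).
  assert (d * (3 * J) = circ_mean s r - J) by (unfold d; field; lra).
  lra.
Qed.

(** One further descent, from [s + 1 > 0], reaches the exponents in [(-1/2, 0)]. *)
Lemma circ_mean_le (s r : R) : - / 2 < s -> 0 <= r < 1 ->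
  circ_mean s r <= 2 * PI * gamma_ratio s.
Proof.
  intros Hs. apply circ_mean_le_step; [assumption|].
  intros q Hq. apply circ_mean_le_of_ge_0; [lra|assumption].
Qed.

(** * Derivatives of the kernel *)

(* [P_alpha = rho * e^{- i alpha psi}], where [psi] is the argument of [1 - conj z]. *)
Definition kernel_mod (a x y : R) : R :=
  Rpower (1 - (x ^ 2 + y ^ 2)) (a + 1) * Rpower ((1 - x) ^ 2 + y ^ 2) (- (a / 2) - 1).

Definition kernel_arg (x y : R) : R := atan (y / (1 - x)).

Definition kernel_re (a x y : R) : R := kernel_mod a x y * cos (a * kernel_arg x y).
Definition kernel_im (a x y : R) : R := - kernel_mod a x y * sin (a * kernel_arg x y).

Lemma disk_facts (x y : R) : x ^ 2 + y ^ 2 < 1 ->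
  0 < 1 - (x ^ 2 + y ^ 2) /\ 0 < 1 - x /\ 0 < (1 - x) ^ 2 + y ^ 2.
Proof. intros H. repeat split; nra. Qed.

Lemma Cmod_sqr (z : C) : Cmod z ^ 2 = fst z ^ 2 + snd z ^ 2.
Proof.
  unfold Cmod. rewrite <- Rsqr_pow2, Rsqr_sqrt; [reflexivity|]. nra.
Qed.

Lemma in_disk_sqr (z : C) : in_disk z <-> fst z ^ 2 + snd z ^ 2 < 1.
Proof.
  unfold in_disk. rewrite <- Cmod_sqr. pose proof (Cmod_ge_0 z). split; intros; nra.
Qed.

(** With [D = |1 - z|^2] and [psi] the argument of [1 - conj z], the two factors of the denominator
    have arguments [- psi] and [(a + 1) psi], so it equals [D^(a/2+1) e^{i a psi}]. *)
Lemma P_alpha_polar (a x y : R) : x ^ 2 + y ^ 2 < 1 ->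
  P_alpha a (x, y) = (kernel_re a x y, kernel_im a x y).
Proof.
  intros Hxy. destruct (disk_facts x y Hxy) as [Hw [Hu HD]].
  unfold P_alpha, kernel_re, kernel_im, kernel_mod.
  rewrite Cmod_sqr; simpl fst; simpl snd.
  set (D := (1 - x) ^ 2 + y ^ 2) in *.
  set (psi := kernel_arg x y).
  assert (HsD : 0 < sqrt D) by now apply sqrt_lt_R0.
  assert (Hq : 0 < 1 + (y / (1 - x))²) by (pose proof (Rle_0_sqr (y / (1 - x))); lra).
  assert (Hsq : 0 < sqrt (1 + (y / (1 - x))²)) by now apply sqrt_lt_R0.
  assert (ED : sqrt D = (1 - x) * sqrt (1 + (y / (1 - x))²)).
  { rewrite <- (sqrt_Rsqr (1 - x)) at 1 by lra. rewrite <- sqrt_mult_alt by apply Rle_0_sqr.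
    f_equal. unfold D, Rsqr. field. lra. }
  assert (Ec : 1 - x = sqrt D * cos psi).
  { unfold psi, kernel_arg. rewrite cos_atan, ED. field. lra. }
  assert (Es : y = sqrt D * sin psi).
  { unfold psi, kernel_arg. rewrite sin_atan, ED. field. lra. }
  assert (Em : Cmod (1 - Cconj (x, y))%C = sqrt D).
  { unfold Cmod, Cminus, Cplus, Copp, Cconj, D; simpl. f_equal. ring. }
  assert (Ew : (1 - Cconj (x, y))%C = (1 - x, y)).
  { unfold Cminus, Cplus, Copp, Cconj; simpl. f_equal; ring. }
  unfold Cpow_right. rewrite Em, Ew. simpl Im; simpl Re. fold (kernel_arg x y). fold psi.
  assert (Eden : ((1 - (x, y)) * (RtoC (Rpower (sqrt D) (a + 1)) * expi ((a + 1) * psi)))%C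
     = (Rpower D (a / 2 + 1) * cos (a * psi), Rpower D (a / 2 + 1) * sin (a * psi))).
  { assert (EP : Rpower (sqrt D) (a + 1) * sqrt D = Rpower D (a / 2 + 1)).
    { rewrite <- (Rpower_1 (sqrt D)) at 2 by assumption. rewrite <- Rpower_plus, <- (Rpower_sqrt D HD), Rpower_mult.
      f_equal. field. }
    rewrite <- EP.
    assert (E1 : (1 - (x, y))%C = (sqrt D * cos psi, - (sqrt D * sin psi))).
    { unfold Cminus, Cplus, Copp; simpl. f_equal; [rewrite <- Ec|rewrite <- Es]; ring. }
    rewrite E1. replace (a * psi) with ((a + 1) * psi - psi) by ring.
    rewrite cos_minus, sin_minus. unfold Cmult, expi, RtoC; simpl. f_equal; ring. }
  rewrite Eden.
  replace (- (a / 2) - 1) with (- (a / 2 + 1)) by ring. rewrite Rpower_Ropp.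
  assert (HP : 0 < Rpower D (a / 2 + 1)) by apply Rpower_pos.
  set (p := Rpower D (a / 2 + 1)) in *.
  pose proof (sin2_cos2 (a * psi)) as Hsc. unfold Rsqr in Hsc.
  unfold Cdiv, Cinv, Cmult, RtoC; simpl.
  assert (E : p * cos (a * psi) * (p * cos (a * psi) * 1) + p * sin (a * psi) * (p * sin (a * psi) * 1) = p * p).
  { replace (p * p) with (p * p * (sin (a * psi) * sin (a * psi) + cos (a * psi) * cos (a * psi))) by (rewrite Hsc; ring). ring. }
  rewrite E. f_equal; field; lra.
Qed.

(* Directional derivatives of [ln rho] and [psi] in the direction [(p, q)]. *)
Definition dlog_mod (a x y p q : R) : R :=
  - 2 * (a + 1) * (x * p + y * q) / (1 - (x ^ 2 + y ^ 2))
  + (a + 2) * ((1 - x) * p - y * q) / ((1 - x) ^ 2 + y ^ 2).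
Definition darg (x y p q : R) : R :=
  (y * p + (1 - x) * q) / ((1 - x) ^ 2 + y ^ 2).

Definition dkernel_re (a x y p q : R) : R :=
  kernel_mod a x y * (cos (a * kernel_arg x y) * dlog_mod a x y p q
                      - a * sin (a * kernel_arg x y) * darg x y p q).
Definition dkernel_im (a x y p q : R) : R :=
  - kernel_mod a x y * (sin (a * kernel_arg x y) * dlog_mod a x y p q
                      + a * cos (a * kernel_arg x y) * darg x y p q).

(* The eta-expanded form is the one produced by [auto_derive]. *)
Lemma Derive_eq (f : R -> R) (x l : R) : is_derive f x l -> Derive (fun t : R => f t) x = l.
Proof. exact (is_derive_unique f x l). Qed.

(** Stated along an arbitrary curve, so that it applies when point and direction are both rotated by
    [e^{-it}]. *)
Lemma is_derive_kernel_mod (a h p q : R) (X Y : R -> R) :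
  X h ^ 2 + Y h ^ 2 < 1 -> is_derive X h p -> is_derive Y h q ->
  is_derive (fun h => kernel_mod a (X h) (Y h)) h
    (kernel_mod a (X h) (Y h) * dlog_mod a (X h) (Y h) p q).
Proof.
  intros Hd HX HY. destruct (disk_facts _ _ Hd) as [Hw [Hu HD]].
  unfold kernel_mod, dlog_mod, Rpower. auto_derive.
  - repeat split; try (now exists p); try (now exists q); simpl in *; lra.
  - rewrite (Derive_eq X h p HX), (Derive_eq Y h q HY).
    replace (1 + - (X h * (X h * 1) + Y h * (Y h * 1))) with (1 - (X h ^ 2 + Y h ^ 2)) by ring.
    replace ((1 + - X h) * ((1 + - X h) * 1) + Y h * (Y h * 1)) with ((1 - X h) ^ 2 + Y h ^ 2) by ring.
    set (e1 := exp _). set (e2 := exp _). field. split; lra.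
Qed.

Lemma is_derive_kernel_arg (h p q : R) (X Y : R -> R) :
  X h ^ 2 + Y h ^ 2 < 1 -> is_derive X h p -> is_derive Y h q ->
  is_derive (fun h => kernel_arg (X h) (Y h)) h (darg (X h) (Y h) p q).
Proof.
  intros Hd HX HY. destruct (disk_facts _ _ Hd) as [Hw [Hu HD]].
  unfold kernel_arg, darg. auto_derive.
  - repeat split; try (now exists p); try (now exists q); lra.
  - rewrite (Derive_eq X h p HX), (Derive_eq Y h q HY).
    unfold Rsqr. field. repeat split; nra.
Qed.

Lemma is_derive_kernel_re (a h p q : R) (X Y : R -> R) :
  X h ^ 2 + Y h ^ 2 < 1 -> is_derive X h p -> is_derive Y h q ->
  is_derive (fun h => kernel_re a (X h) (Y h)) h (dkernel_re a (X h) (Y h) p q).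
Proof.
  intros Hd HX HY.
  pose proof (is_derive_kernel_mod a h p q X Y Hd HX HY) as Hm.
  pose proof (is_derive_kernel_arg h p q X Y Hd HX HY) as Ha.
  unfold kernel_re, dkernel_re.
  set (m := fun h => kernel_mod a (X h) (Y h)) in Hm. set (psi := fun h => kernel_arg (X h) (Y h)) in Ha.
  change (is_derive (fun h => m h * cos (a * psi h)) h
    (m h * (cos (a * psi h) * dlog_mod a (X h) (Y h) p q - a * sin (a * psi h) * darg (X h) (Y h) p q))).
  auto_derive.
  - repeat split; eexists; eassumption.
  - rewrite (Derive_eq m h _ Hm), (Derive_eq psi h _ Ha). unfold m. ring.
Qed.

Lemma is_derive_kernel_im (a h p q : R) (X Y : R -> R) :
  X h ^ 2 + Y h ^ 2 < 1 -> is_derive X h p -> is_derive Y h q ->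
  is_derive (fun h => kernel_im a (X h) (Y h)) h (dkernel_im a (X h) (Y h) p q).
Proof.
  intros Hd HX HY.
  pose proof (is_derive_kernel_mod a h p q X Y Hd HX HY) as Hm.
  pose proof (is_derive_kernel_arg h p q X Y Hd HX HY) as Ha.
  unfold kernel_im, dkernel_im.
  set (m := fun h => kernel_mod a (X h) (Y h)) in Hm. set (psi := fun h => kernel_arg (X h) (Y h)) in Ha.
  change (is_derive (fun h => - m h * sin (a * psi h)) h
    (- m h * (sin (a * psi h) * dlog_mod a (X h) (Y h) p q + a * cos (a * psi h) * darg (X h) (Y h) p q))).
  auto_derive.
  - repeat split; eexists; eassumption.
  - rewrite (Derive_eq m h _ Hm), (Derive_eq psi h _ Ha). unfold m. ring.
Qed.

Section Continuity.

Variables (a h t : R) (X Y p q : R -> R -> R).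
Hypotheses (Hd : X h t ^ 2 + Y h t ^ 2 < 1)
  (HX : continuity_2d_pt X h t) (HY : continuity_2d_pt Y h t)
  (Hp : continuity_2d_pt p h t) (Hq : continuity_2d_pt q h t).

Lemma continuity_kernel_re :
  continuity_2d_pt (fun u v => kernel_re a (X u v) (Y u v)) h t.
Proof.
  destruct (disk_facts _ _ Hd) as [Hw [Hu HD]].
  unfold kernel_re, kernel_mod, kernel_arg, Rpower, Rdiv; simpl. continuity_2d; simpl in *; lra.
Qed.

Lemma continuity_kernel_im :
  continuity_2d_pt (fun u v => kernel_im a (X u v) (Y u v)) h t.
Proof.
  destruct (disk_facts _ _ Hd) as [Hw [Hu HD]].
  unfold kernel_im, kernel_mod, kernel_arg, Rpower, Rdiv; simpl. continuity_2d; simpl in *; lra.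
Qed.

Lemma continuity_dkernel_re :
  continuity_2d_pt (fun u v => dkernel_re a (X u v) (Y u v) (p u v) (q u v)) h t.
Proof.
  destruct (disk_facts _ _ Hd) as [Hw [Hu HD]].
  unfold dkernel_re, dlog_mod, darg, kernel_mod, kernel_arg, Rpower, Rdiv; simpl.
  continuity_2d; simpl in *; lra.
Qed.

Lemma continuity_dkernel_im :
  continuity_2d_pt (fun u v => dkernel_im a (X u v) (Y u v) (p u v) (q u v)) h t.
Proof.
  destruct (disk_facts _ _ Hd) as [Hw [Hu HD]].
  unfold dkernel_im, dlog_mod, darg, kernel_mod, kernel_arg, Rpower, Rdiv; simpl.
  continuity_2d; simpl in *; lra.
Qed.

End Continuity.

(* With [v = p + i q] and the unimodular [e = (1 - conj z) / (1 - z)],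
   [(1 - |z|^2) * (dlog_mod - i a darg) = e v - a conj z v + (a + 1) conj (e v)]. *)
Lemma dlog_kernel_le (a x y p q : R) : -1 < a -> x ^ 2 + y ^ 2 < 1 -> p ^ 2 + q ^ 2 = 1 ->
  Cmod (dlog_mod a x y p q, - (a * darg x y p q)) <= (a + 2) / (1 - Cmod (x, y)).
Proof.
  intros Ha Hxy Hpq. destruct (disk_facts x y Hxy) as [Hw [Hu HD]].
  set (D := (1 - x) ^ 2 + y ^ 2) in *. set (w := 1 - (x ^ 2 + y ^ 2)) in *.
  set (e := (((1 - x) ^ 2 - y ^ 2) / D, 2 * (1 - x) * y / D) : C).
  set (v := (p, q) : C). set (z := (x, y) : C).
  assert (Hmod1 : forall z : C, fst z ^ 2 + snd z ^ 2 = 1 -> Cmod z = 1).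
  { intros z' H. unfold Cmod. rewrite H. apply sqrt_1. }
  assert (He : Cmod e = 1).
  { apply Hmod1. unfold e, D; simpl. field. fold D. simpl in D. unfold D in HD. lra. }
  assert (Hv : Cmod v = 1) by (apply Hmod1; exact Hpq).
  set (dl := (dlog_mod a x y p q, - (a * darg x y p q)) : C).
  assert (E : (RtoC w * dl)%C
    = (e * v + (- RtoC a * (Cconj z * v) + RtoC (a + 1) * Cconj (e * v)))%C).
  { unfold dl, e, v, z, dlog_mod, darg, Cmult, Cplus, Copp, Cconj, RtoC; simpl.
    fold D. fold w. replace ((1 - x) * ((1 - x) * 1) + y * (y * 1)) with D by (unfold D; ring).
    replace (1 - (x * (x * 1) + y * (y * 1))) with w by (unfold w; ring).
    f_equal; unfold D, w; field; fold D; fold w; unfold D, w in *; simpl in *; lra. }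
  assert (Hr : Cmod z ^ 2 = x ^ 2 + y ^ 2) by apply Cmod_sqr.
  pose proof (Cmod_ge_0 z) as Hr0. set (r := Cmod z) in *.
  assert (Hr1 : r < 1) by nra.
  (* The triangle inequality gives [1 + |a| r + (a + 1)], and [|a| <= a + 2] because [a > -1].
     Dividing by [w = (1 - r) (1 + r)] leaves [1 / (1 - r)]. *)
  assert (Hle : w * Cmod dl <= (a + 2) * (1 + r)).
  { replace w with (Cmod (RtoC w)) by (rewrite Cmod_R; apply Rabs_pos_eq; lra).
    rewrite <- Cmod_mult, E.
    apply Rle_trans with (1 := Cmod_triangle _ _).
    pose proof (Cmod_triangle (- RtoC a * (Cconj z * v)) (RtoC (a + 1) * Cconj (e * v))) as H2.
    rewrite !Cmod_mult, Cmod_opp, !Cmod_R, !Cmod_conj, !Cmod_mult, He, Hv in H2.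
    rewrite Cmod_mult, He, Hv. fold r in H2. rewrite (Rabs_pos_eq (a + 1)) in H2 by lra.
    assert (Rabs a * r <= (a + 2) * r).
    { apply Rmult_le_compat_r; [assumption|]. apply Rabs_le. lra. }
    nra. }
  apply Rmult_le_reg_l with w; [assumption|].
  apply Rle_trans with (1 := Hle). right. unfold w. rewrite <- Hr. field. lra.
Qed.

(** The derivative is the kernel times its logarithmic derivative, and the phase of the kernel is
    unimodular. *)
Lemma dkernel_le (a x y p q : R) : -1 < a -> x ^ 2 + y ^ 2 < 1 -> p ^ 2 + q ^ 2 = 1 ->
  Cmod (dkernel_re a x y p q, dkernel_im a x y p q)
  <= kernel_mod a x y * ((a + 2) / (1 - Cmod (x, y))).
Proof.
  intros Ha Hxy Hpq.
  assert (Hm : 0 < kernel_mod a x y) by (apply Rmult_lt_0_compat; apply Rpower_pos).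
  set (dl := (dlog_mod a x y p q, - (a * darg x y p q)) : C).
  replace (dkernel_re a x y p q, dkernel_im a x y p q)
    with (RtoC (kernel_mod a x y) * (expi (- (a * kernel_arg x y)) * dl))%C.
  - rewrite !Cmod_mult, Cmod_R, Rabs_pos_eq by lra.
    replace (Cmod (expi (- (a * kernel_arg x y)))) with 1.
    + rewrite Rmult_1_l. apply Rmult_le_compat_l; [lra|]. now apply dlog_kernel_le.
    + unfold Cmod, expi; simpl. rewrite !Rmult_1_r.
      pose proof (sin2_cos2 (- (a * kernel_arg x y))) as H. unfold Rsqr in H.
      rewrite Rplus_comm, H. now rewrite sqrt_1.
  - unfold dl, dkernel_re, dkernel_im, expi, Cmult, RtoC; simpl. rewrite cos_neg, sin_neg. f_equal; ring.
Qed.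

(** * Differentiating the Poisson integral *)

Lemma Cmod_expi (t : R) : Cmod (expi t) = 1.
Proof.
  unfold Cmod, expi; simpl. rewrite !Rmult_1_r.
  pose proof (sin2_cos2 t) as H. unfold Rsqr in H. rewrite Rplus_comm, H. apply sqrt_1.
Qed.

Lemma circle_expi (z : C) : Cmod z = 1 -> exists t, z = expi t.
Proof.
  intros Hz. destruct z as [c s].
  assert (Hcs : c ^ 2 + s ^ 2 = 1).
  { pose proof (Cmod_sqr (c, s)) as H. simpl fst in H; simpl snd in H. rewrite Hz in H. lra. }
  assert (Hc : -1 <= c <= 1) by nra.
  assert (Hsin : sin (acos c) = Rabs s).
  { rewrite sin_acos by assumption. rewrite <- sqrt_Rsqr_abs. f_equal. unfold Rsqr. lra. }
  destruct (Rle_dec 0 s) as [Hs|Hs].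
  - exists (acos c). unfold expi. now rewrite cos_acos, Hsin, Rabs_pos_eq by assumption.
  - exists (- acos c). unfold expi. rewrite cos_neg, sin_neg, cos_acos, Hsin, Rabs_left by lra.
    f_equal. ring.
Qed.

Lemma polar_form (z : C) : exists t, z = (Cmod z * cos t, Cmod z * sin t).
Proof.
  destruct (Req_dec (Cmod z) 0) as [H|H].
  - exists 0. rewrite (Cmod_eq_0 z H), Cmod_0. unfold RtoC. f_equal; ring.
  - destruct (circle_expi (RtoC (/ Cmod z) * z)%C) as [t Ht].
    + pose proof (Cmod_ge_0 z). rewrite Cmod_mult, Cmod_R, Rabs_pos_eq.
      * now apply Rinv_l.
      * left; apply Rinv_0_lt_compat; lra.
    + exists t. unfold expi in Ht. injection Ht as H1 H2.
      rewrite <- H1, <- H2. destruct z as [x y]; simpl fst; simpl snd. f_equal; field; assumption.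
Qed.

(** With [inner_le_Cmod] this is the dual description of the modulus; it reduces estimates of
    complex integrals to real integrals, one direction at a time. *)
Lemma Cmod_le_of_inner_le (j : C) (L : R) :
  (forall b1 b2 : R, b1 ^ 2 + b2 ^ 2 = 1 -> b1 * fst j + b2 * snd j <= L) -> Cmod j <= L.
Proof.
  intros H. destruct (polar_form j) as [t Ht].
  pose proof (sin2_cos2 t) as Hsc. unfold Rsqr in Hsc.
  specialize (H (cos t) (sin t) ltac:(lra)). rewrite Ht in H; simpl in H.
  replace (cos t * (Cmod j * cos t) + sin t * (Cmod j * sin t))
    with (Cmod j * (sin t * sin t + cos t * cos t)) in H by ring.
  rewrite Hsc in H. lra.
Qed.

Lemma inner_le_Cmod (b1 b2 : R) (j : C) :
  b1 ^ 2 + b2 ^ 2 = 1 -> b1 * fst j + b2 * snd j <= Cmod j.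
Proof.
  intros Hb. destruct (polar_form j) as [t Ht]. pose proof (Cmod_ge_0 j).
  rewrite Ht at 1 2; simpl.
  pose proof (sin2_cos2 t) as Hsc. unfold Rsqr in Hsc.
  pose proof (pow2_ge_0 (b1 - cos t)). pose proof (pow2_ge_0 (b2 - sin t)).
  assert (b1 * cos t + b2 * sin t <= 1) by nra. nra.
Qed.

(** First coordinate of [(x + i y) e^{-it}]. *)
Definition rot_x (x y t : R) : R := x * cos t + y * sin t.
Definition rot_y (x y t : R) : R := y * cos t - x * sin t.

Lemma rot_norm (x y t : R) : rot_x x y t ^ 2 + rot_y x y t ^ 2 = x ^ 2 + y ^ 2.
Proof.
  unfold rot_x, rot_y. pose proof (sin2_cos2 t) as H. unfold Rsqr in H.
  replace (x ^ 2 + y ^ 2) with ((x ^ 2 + y ^ 2) * (sin t * sin t + cos t * cos t)) by (rewrite H; ring).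
  ring.
Qed.

Lemma mult_expi_neg (x y t : R) : ((x, y) * expi (- t))%C = (rot_x x y t, rot_y x y t).
Proof.
  unfold Cmult, expi, rot_x, rot_y; simpl. rewrite cos_neg, sin_neg. f_equal; ring.
Qed.

(** For [z = r e^{i t0}] the integrand depends only on [t - t0]; periodicity removes the shift and
    reduces the claim to a real point. *)
Lemma RInt_kernel_mod (a x y : R) : x ^ 2 + y ^ 2 < 1 ->
  is_RInt (fun t => kernel_mod a (rot_x x y t) (rot_y x y t)) 0 (2 * PI)
    (circ_mean (a / 2) (Cmod (x, y))).
Proof.
  intros Hxy.
  destruct (polar_form (x, y)) as [t0 Ht0].
  assert (Hd : in_disk (x, y)) by (apply in_disk_sqr; exact Hxy). unfold in_disk in Hd.
  assert (Hr2 : Cmod (x, y) ^ 2 = x ^ 2 + y ^ 2) by apply Cmod_sqr.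
  pose proof (Cmod_ge_0 (x, y)) as Hr0. set (r := Cmod (x, y)) in *.
  injection Ht0 as Hx Hy.
  set (F := fun t => Rpower (1 - r ^ 2) (2 * (a / 2) + 1) * Rpower (circ r t) (- (a / 2) - 1)).
  assert (HF : forall t, continuous F t).
  { intros t. apply (continuous_comp_circ (fun x => Rpower (1 - r ^ 2) (2 * (a / 2) + 1) * Rpower x (- (a / 2) - 1))); [lra|].
    intros u Hu. apply (ex_derive_continuous (fun x => Rpower (1 - r ^ 2) (2 * (a / 2) + 1) * Rpower x (- (a / 2) - 1))).
    unfold Rpower. auto_derive. exact Hu. }
  assert (E : forall t, F (1 * t + - t0) = kernel_mod a (rot_x x y t) (rot_y x y t)).
  { intros t. unfold F, kernel_mod. rewrite rot_norm, Hr2. f_equal; [f_equal; field|]. f_equal.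
    replace ((1 - rot_x x y t) ^ 2 + rot_y x y t ^ 2)
      with (1 - 2 * rot_x x y t + (rot_x x y t ^ 2 + rot_y x y t ^ 2)) by ring.
    rewrite rot_norm, <- Hr2. unfold circ, rot_x.
    replace (1 * t + - t0) with (t - t0) by ring. rewrite cos_minus, Hx, Hy. ring. }
  apply (is_RInt_ext (fun t => F (1 * t + - t0))); [intros; apply E|].
  rewrite <- RInt_kernel_circ by lra. fold F.
  rewrite <- (RInt_periodic_shift F (- t0) HF) by (intros; unfold F; now rewrite circ_periodic).
  assert (H : is_RInt F (1 * 0 + - t0) (1 * (2 * PI) + - t0) (RInt F (- t0) (- t0 + 2 * PI))).
  { replace (1 * 0 + - t0) with (- t0) by ring. replace (1 * (2 * PI) + - t0) with (- t0 + 2 * PI) by ring.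
    apply (RInt_correct F). now apply ex_RInt_everywhere. }
  apply (is_RInt_comp_lin F 1 (- t0) 0 (2 * PI)) in H.
  revert H. apply is_RInt_ext. intros t _. apply (scal_one (F (1 * t + - t0))).
Qed.

Section PoissonIntegral.

Variables (a : R) (c1 c2 : R -> R).
Hypotheses (Hc1 : forall t, continuous c1 t) (Hc2 : forall t, continuous c2 t).

(** One real integral for both components of [f]: up to the factor [2 PI], the choice
    [(c1, c2) = (g1, - g2)] gives the real part and [(g2, g1)] the imaginary part, where [g1] and
    [g2] are those of [fstar]. *)
Definition poisson_int (x y : R) : R :=
  RInt (fun t => kernel_re a (rot_x x y t) (rot_y x y t) * c1 t
               + kernel_im a (rot_x x y t) (rot_y x y t) * c2 t) 0 (2 * PI).

Definition dpoisson_integrand (x y p q t : R) : R :=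
  dkernel_re a (rot_x x y t) (rot_y x y t) (rot_x p q t) (rot_y p q t) * c1 t
  + dkernel_im a (rot_x x y t) (rot_y x y t) (rot_x p q t) (rot_y p q t) * c2 t.

Definition dpoisson_int (x y p q : R) : R :=
  RInt (dpoisson_integrand x y p q) 0 (2 * PI).

Lemma continuity_2d_cos (h t : R) : continuity_2d_pt (fun _ v => cos v) h t.
Proof. apply (continuity_2d_pt_comp1 cos (fun _ v => v)); [apply continuous_cos|apply continuity_2d_pt_id2]. Qed.

Lemma continuity_2d_sin (h t : R) : continuity_2d_pt (fun _ v => sin v) h t.
Proof. apply (continuity_2d_pt_comp1 sin (fun _ v => v)); [apply continuous_sin|apply continuity_2d_pt_id2]. Qed.

Lemma continuity_2d_snd (c : R -> R) (h t : R) : (forall t, continuous c t) ->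
  continuity_2d_pt (fun _ v => c v) h t.
Proof. intros Hc. apply (continuity_2d_pt_comp1 c (fun _ v => v)); [apply Hc|apply continuity_2d_pt_id2]. Qed.

Lemma continuous_of_2d (F : R -> R -> R) (h t : R) :
  continuity_2d_pt F h t -> continuous (F h) t.
Proof.
  intros H. apply continuity_pt_filterlim. apply continuity_pt_locally. intros eps.
  destruct (H eps) as [d Hd]. exists d. intros v Hv. apply Hd; [|exact Hv].
  rewrite Rminus_diag_eq by reflexivity. rewrite Rabs_R0. apply cond_pos.
Qed.

Lemma continuity_2d_poisson_integrand (x0 y0 p q h t : R) :
  (x0 + h * p) ^ 2 + (y0 + h * q) ^ 2 < 1 ->
  continuity_2d_pt (fun u v => kernel_re a (rot_x (x0 + u * p) (y0 + u * q) v) (rot_y (x0 + u * p) (y0 + u * q) v) * c1 v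
     + kernel_im a (rot_x (x0 + u * p) (y0 + u * q) v) (rot_y (x0 + u * p) (y0 + u * q) v) * c2 v) h t.
Proof.
  intros Hd. pose proof (continuity_2d_cos h t). pose proof (continuity_2d_sin h t).
  pose proof (continuity_2d_snd c1 h t Hc1). pose proof (continuity_2d_snd c2 h t Hc2).
  rewrite <- (rot_norm _ _ t) in Hd.
  assert (HX : continuity_2d_pt (fun u v => rot_x (x0 + u * p) (y0 + u * q) v) h t)
    by (unfold rot_x; continuity_2d).
  assert (HY : continuity_2d_pt (fun u v => rot_y (x0 + u * p) (y0 + u * q) v) h t)
    by (unfold rot_y; continuity_2d).
  pose proof (continuity_kernel_re a h t _ _ Hd HX HY).
  pose proof (continuity_kernel_im a h t _ _ Hd HX HY).
  continuity_2d.
Qed.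

Lemma continuity_2d_dpoisson_integrand (x0 y0 p q h t : R) :
  (x0 + h * p) ^ 2 + (y0 + h * q) ^ 2 < 1 ->
  continuity_2d_pt (fun u v => dpoisson_integrand (x0 + u * p) (y0 + u * q) p q v) h t.
Proof.
  intros Hd. pose proof (continuity_2d_cos h t). pose proof (continuity_2d_sin h t).
  pose proof (continuity_2d_snd c1 h t Hc1). pose proof (continuity_2d_snd c2 h t Hc2).
  rewrite <- (rot_norm _ _ t) in Hd.
  assert (HX : continuity_2d_pt (fun u v => rot_x (x0 + u * p) (y0 + u * q) v) h t)
    by (unfold rot_x; continuity_2d).
  assert (HY : continuity_2d_pt (fun u v => rot_y (x0 + u * p) (y0 + u * q) v) h t)
    by (unfold rot_y; continuity_2d).
  assert (Hp : continuity_2d_pt (fun u v => rot_x p q v) h t) by (unfold rot_x; continuity_2d).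
  assert (Hq : continuity_2d_pt (fun u v => rot_y p q v) h t) by (unfold rot_y; continuity_2d).
  pose proof (continuity_dkernel_re a h t _ _ _ _ Hd HX HY Hp Hq).
  pose proof (continuity_dkernel_im a h t _ _ _ _ Hd HX HY Hp Hq).
  unfold dpoisson_integrand. continuity_2d.
Qed.

Lemma ex_RInt_poisson (x y b b' : R) : x ^ 2 + y ^ 2 < 1 ->
  ex_RInt (fun t => kernel_re a (rot_x x y t) (rot_y x y t) * c1 t
               + kernel_im a (rot_x x y t) (rot_y x y t) * c2 t) b b'.
Proof.
  intros Hd. apply ex_RInt_everywhere. intros t.
  pose proof (continuity_2d_poisson_integrand x y 0 0 0 t) as H.
  rewrite Rmult_0_r, !Rplus_0_r in H.
  apply (continuous_of_2d (fun _ t => kernel_re a (rot_x x y t) (rot_y x y t) * c1 t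
               + kernel_im a (rot_x x y t) (rot_y x y t) * c2 t) 0).
  apply continuity_2d_pt_ext with (2 := H Hd).
  intros u v. now rewrite !Rmult_0_r, !Rplus_0_r.
Qed.

Lemma is_RInt_dpoisson (x y p q : R) : x ^ 2 + y ^ 2 < 1 ->
  is_RInt (dpoisson_integrand x y p q) 0 (2 * PI) (dpoisson_int x y p q).
Proof.
  intros Hd. apply (RInt_correct (dpoisson_integrand x y p q)).
  apply ex_RInt_everywhere. intros t.
  pose proof (continuity_2d_dpoisson_integrand x y p q 0 t) as H.
  rewrite !Rmult_0_l, !Rplus_0_r in H. specialize (H Hd). apply continuous_of_2d in H.
  now rewrite !Rmult_0_l, !Rplus_0_r in H.
Qed.

Lemma is_derive_poisson_int (x0 y0 p q h : R) :
  (x0 + h * p) ^ 2 + (y0 + h * q) ^ 2 < 1 ->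
  is_derive (fun h => poisson_int (x0 + h * p) (y0 + h * q)) h
    (dpoisson_int (x0 + h * p) (y0 + h * q) p q).
Proof.
  intros Hh.
  set (F := fun u t => kernel_re a (rot_x (x0 + u * p) (y0 + u * q) t) (rot_y (x0 + u * p) (y0 + u * q) t) * c1 t
     + kernel_im a (rot_x (x0 + u * p) (y0 + u * q) t) (rot_y (x0 + u * p) (y0 + u * q) t) * c2 t).
  assert (HD : forall u t, (x0 + u * p) ^ 2 + (y0 + u * q) ^ 2 < 1 ->
    is_derive (fun u => F u t) u (dpoisson_integrand (x0 + u * p) (y0 + u * q) p q t)).
  { intros u t Hu. unfold F, dpoisson_integrand.
    rewrite <- (rot_norm _ _ t) in Hu.
    assert (HX : is_derive (fun u => rot_x (x0 + u * p) (y0 + u * q) t) u (rot_x p q t))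
      by (unfold rot_x; auto_derive; trivial; ring).
    assert (HY : is_derive (fun u => rot_y (x0 + u * p) (y0 + u * q) t) u (rot_y p q t))
      by (unfold rot_y; auto_derive; trivial; ring).
    pose proof (is_derive_kernel_re a u _ _ _ _ Hu HX HY) as H1.
    pose proof (is_derive_kernel_im a u _ _ _ _ Hu HX HY) as H2.
    apply (is_derive_plus (fun u => kernel_re a (rot_x (x0 + u * p) (y0 + u * q) t) (rot_y (x0 + u * p) (y0 + u * q) t) * c1 t)
      (fun u => kernel_im a (rot_x (x0 + u * p) (y0 + u * q) t) (rot_y (x0 + u * p) (y0 + u * q) t) * c2 t)).
    - exact (is_derive_scal_l _ _ _ (c1 t) H1).
    - exact (is_derive_scal_l _ _ _ (c2 t) H2). }
  assert (Hloc : locally h (fun u => (x0 + u * p) ^ 2 + (y0 + u * q) ^ 2 < 1)).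
  { assert (Hc : continuous (fun u => (x0 + u * p) ^ 2 + (y0 + u * q) ^ 2) h).
    { apply (ex_derive_continuous (fun u => (x0 + u * p) ^ 2 + (y0 + u * q) ^ 2)). auto_derive. trivial. }
    exact (Hc _ (open_lt 1 _ Hh)). }
  unfold dpoisson_int.
  rewrite (RInt_ext _ (fun t => Derive (fun u => F u t) h))
    by (intros t _; symmetry; now apply is_derive_unique, HD).
  apply (is_derive_RInt_param F).
  - revert Hloc. apply filter_imp. intros u Hu t _. eexists. now apply HD.
  - intros t _.
    apply (continuity_2d_pt_ext_loc (fun u v => dpoisson_integrand (x0 + u * p) (y0 + u * q) p q v)).
    + destruct Hloc as [e He]. exists e. intros u v Hu _. symmetry. apply is_derive_unique, HD, He, Hu.
    + now apply continuity_2d_dpoisson_integrand.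
  - revert Hloc. apply filter_imp. intros u Hu. now apply ex_RInt_poisson.
Qed.

Lemma dpoisson_integrand_lin (x y p q t : R) :
  dpoisson_integrand x y p q t
  = p * dpoisson_integrand x y 1 0 t + q * dpoisson_integrand x y 0 1 t.
Proof.
  unfold dpoisson_integrand, dkernel_re, dkernel_im, dlog_mod, darg, Rdiv, rot_x, rot_y. ring.
Qed.

Lemma dpoisson_int_lin (x y p q : R) : x ^ 2 + y ^ 2 < 1 ->
  dpoisson_int x y p q = p * dpoisson_int x y 1 0 + q * dpoisson_int x y 0 1.
Proof.
  intros Hd. apply RInt_of_is_RInt.
  apply (is_RInt_ext (fun t => p * dpoisson_integrand x y 1 0 t + q * dpoisson_integrand x y 0 1 t)).
  - intros t _. symmetry. apply dpoisson_integrand_lin.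
  - apply is_RInt_lin; now apply is_RInt_dpoisson.
Qed.

Lemma Derive_poisson_x (F : R -> R) (x y : R) : x ^ 2 + y ^ 2 < 1 ->
  (forall u, u ^ 2 + y ^ 2 < 1 -> F u = / (2 * PI) * poisson_int u y) ->
  Derive F x = / (2 * PI) * dpoisson_int x y 1 0.
Proof.
  intros Hd HF. apply is_derive_unique.
  (* The horizontal line starts at abscissa 0, which makes its parameter the coordinate itself. *)
  apply (is_derive_ext_loc (fun u => scal (/ (2 * PI)) (poisson_int (0 + u * 1) (y + u * 0)))).
  - assert (Hc : continuous (fun u => u ^ 2 + y ^ 2) x).
    { apply (ex_derive_continuous (fun u => u ^ 2 + y ^ 2)). auto_derive. trivial. }
    assert (Hl : locally x (fun u => u ^ 2 + y ^ 2 < 1)) by exact (Hc _ (open_lt 1 _ Hd)).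
    revert Hl. apply filter_imp. intros u Hu.
    rewrite HF by exact Hu. now rewrite Rplus_0_l, Rmult_1_r, Rmult_0_r, Rplus_0_r.
  - pose proof (is_derive_poisson_int 0 y 1 0 x) as H.
    replace (0 + x * 1) with x in H by ring. replace (y + x * 0) with y in H by ring.
    exact (is_derive_scal _ _ (/ (2 * PI)) _ (H Hd)).
Qed.

Lemma Derive_poisson_y (F : R -> R) (x y : R) : x ^ 2 + y ^ 2 < 1 ->
  (forall u, x ^ 2 + u ^ 2 < 1 -> F u = / (2 * PI) * poisson_int x u) ->
  Derive F y = / (2 * PI) * dpoisson_int x y 0 1.
Proof.
  intros Hd HF. apply is_derive_unique.
  apply (is_derive_ext_loc (fun u => scal (/ (2 * PI)) (poisson_int (x + u * 0) (0 + u * 1)))).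
  - assert (Hc : continuous (fun u => x ^ 2 + u ^ 2) y).
    { apply (ex_derive_continuous (fun u => x ^ 2 + u ^ 2)). auto_derive. trivial. }
    assert (Hl : locally y (fun u => x ^ 2 + u ^ 2 < 1)) by exact (Hc _ (open_lt 1 _ Hd)).
    revert Hl. apply filter_imp. intros u Hu.
    rewrite HF by exact Hu. now rewrite Rplus_0_l, Rmult_1_r, Rmult_0_r, Rplus_0_r.
  - pose proof (is_derive_poisson_int x 0 0 1 y) as H.
    replace (0 + y * 1) with y in H by ring. replace (x + y * 0) with x in H by ring.
    exact (is_derive_scal _ _ (/ (2 * PI)) _ (H Hd)).
Qed.

End PoissonIntegral.

Lemma continuous_boundary (fstar : C -> C) : continuous_on on_circle fstar ->
  forall t, continuous (fun t => fst (fstar (expi t))) t /\ continuous (fun t => snd (fstar (expi t))) t.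
Proof.
  intros Hf t.
  (* Continuity of [fstar] is relative to the circle, so [expi] has to converge within it. *)
  assert (Hexpi : filterlim expi (locally t) (within on_circle (locally (expi t)))).
  { intros P [eps HP].
    assert (H1 : locally t (fun u => ball (cos t) eps (cos u))) by (apply continuous_cos, locally_ball).
    assert (H2 : locally t (fun u => ball (sin t) eps (sin u))) by (apply continuous_sin, locally_ball).
    change (locally t (fun u => P (expi u))).
    generalize (filter_and _ _ H1 H2). apply filter_imp. intros u Hu. exact (HP (expi u) Hu (Cmod_expi u)). }
  pose proof (filterlim_comp _ _ _ _ _ _ _ _ Hexpi (Hf (expi t) (Cmod_expi t))) as H.
  split.
  - apply (filterlim_comp _ _ _ (fun t => fstar (expi t)) fst _ (locally (fstar (expi t)))); [exact H|].
    apply continuous_fst.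
  - apply (filterlim_comp _ _ _ (fun t => fstar (expi t)) snd _ (locally (fstar (expi t)))); [exact H|].
    apply continuous_snd.
Qed.

(** * The Jacobian bound *)

Lemma CRInt_pair (g : R -> C) (u v : R -> R) (a b : R) :
  (forall t, g t = (u t, v t)) -> ex_RInt u a b -> ex_RInt v a b ->
  CRInt g a b = (RInt u a b, RInt v a b).
Proof.
  intros Hg Hu Hv. unfold CRInt. apply (is_RInt_unique (V := C_R_CompleteNormedModule)).
  apply (is_RInt_fct_extend_pair (U := R_NormedModule) (V := R_NormedModule)).
  - apply (is_RInt_ext u); [intros t _; now rewrite Hg|]. exact (RInt_correct u a b Hu).
  - apply (is_RInt_ext v); [intros t _; now rewrite Hg|]. exact (RInt_correct v a b Hv).
Qed.

Lemma gamma_ratio_c_alpha (a : R) : -1 < a ->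
  gamma_ratio (a / 2) = / c_alpha a.
Proof.
  intros Ha. unfold gamma_ratio, c_alpha. replace (2 * (a / 2) + 1) with (a + 1) by field.
  pose proof (Gamma_pos (a / 2 + 1) ltac:(lra)). pose proof (Gamma_pos (a + 1) ltac:(lra)).
  field. lra.
Qed.

Lemma c_alpha_pos (a : R) : -1 < a -> 0 < c_alpha a.
Proof.
  intros Ha. apply Rdiv_lt_0_compat; [apply pow_lt|]; apply Gamma_pos; lra.
Qed.

Section JacobianBound.

Variables (a M : R) (f fstar : C -> C).
Hypotheses (Ha : -1 < a) (Hrep : poisson_represented a f fstar)
  (Hcont : continuous_on on_circle fstar)
  (HM : forall t, Cmod (fstar (expi t)) <= M).

Let g1 (t : R) : R := fst (fstar (expi t)).
Let g2 (t : R) : R := snd (fstar (expi t)).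
Let g2' (t : R) : R := - g2 t.

Lemma boundary_continuous :
  (forall t, continuous g1 t) /\ (forall t, continuous g2 t) /\ (forall t, continuous g2' t).
Proof.
  repeat split; intros t; destruct (continuous_boundary fstar Hcont t) as [H1 H2]; try assumption.
  apply (continuous_opp g2). exact H2.
Qed.

Lemma poisson_components (x y : R) : x ^ 2 + y ^ 2 < 1 ->
  f (x, y) = (/ (2 * PI) * poisson_int a g1 g2' x y, / (2 * PI) * poisson_int a g2 g1 x y).
Proof.
  intros Hd. destruct boundary_continuous as [H1 [H2 H2']].
  rewrite Hrep by (apply in_disk_sqr; exact Hd).
  assert (E : forall t, (P_alpha a ((x, y) * expi (- t)) * fstar (expi t))%C
    = (kernel_re a (rot_x x y t) (rot_y x y t) * g1 t + kernel_im a (rot_x x y t) (rot_y x y t) * g2' t,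
       kernel_re a (rot_x x y t) (rot_y x y t) * g2 t + kernel_im a (rot_x x y t) (rot_y x y t) * g1 t)).
  { intros t. rewrite mult_expi_neg, P_alpha_polar by (now rewrite rot_norm).
    unfold g1, g2', g2, Cmult; simpl. f_equal; ring. }
  rewrite (CRInt_pair _ _ _ 0 (2 * PI) E) by (now apply ex_RInt_poisson).
  unfold poisson_int, Cmult, RtoC; simpl. f_equal; ring.
Qed.

Lemma jacobian_apply_poisson (x y p q : R) : x ^ 2 + y ^ 2 < 1 ->
  jacobian_apply f (x, y) (p, q)
  = (/ (2 * PI) * dpoisson_int a g1 g2' x y p q, / (2 * PI) * dpoisson_int a g2 g1 x y p q).
Proof.
  intros Hd. destruct boundary_continuous as [H1 [H2 H2']].
  unfold jacobian_apply, partial_x, partial_y; simpl.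
  rewrite (Derive_poisson_x a g1 g2' H1 H2' (fun u => Re (f (u, y))) x y Hd)
    by (intros u Hu; now rewrite (poisson_components u y Hu)).
  rewrite (Derive_poisson_x a g2 g1 H2 H1 (fun u => Im (f (u, y))) x y Hd)
    by (intros u Hu; now rewrite (poisson_components u y Hu)).
  rewrite (Derive_poisson_y a g1 g2' H1 H2' (fun u => Re (f (x, u))) x y Hd)
    by (intros u Hu; now rewrite (poisson_components x u Hu)).
  rewrite (Derive_poisson_y a g2 g1 H2 H1 (fun u => Im (f (x, u))) x y Hd)
    by (intros u Hu; now rewrite (poisson_components x u Hu)).
  rewrite (dpoisson_int_lin a g1 g2' H1 H2' x y p q Hd), (dpoisson_int_lin a g2 g1 H2 H1 x y p q Hd).
  f_equal; ring.
Qed.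

(** Projected on a unit vector [(b1, b2)], the differentiated integrand is an inner product with the
    complex product of the kernel derivative and [fstar], hence at most [M] times the modulus of the
    former. *)
Lemma jacobian_apply_le (z v : C) : in_disk z -> Cmod v = 1 ->
  Cmod (jacobian_apply f z v) <= M * (a + 2) / c_alpha a * (1 / (1 - Cmod z)).
Proof.
  intros Hz Hv. destruct z as [x y], v as [p q].
  assert (Hd : x ^ 2 + y ^ 2 < 1) by (now apply in_disk_sqr in Hz).
  unfold in_disk in Hz.
  assert (Hpq : p ^ 2 + q ^ 2 = 1).
  { pose proof (Cmod_sqr (p, q)) as H. rewrite Hv in H. simpl fst in H; simpl snd in H. lra. }
  rewrite jacobian_apply_poisson by assumption.
  destruct boundary_continuous as [H1 [H2 H2']].
  pose proof two_PI_pos as Hpi. assert (Hpi' : 0 < / (2 * PI)) by (apply Rinv_0_lt_compat; assumption).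
  assert (HM0 : 0 <= M) by (apply Rle_trans with (2 := HM 0); apply Cmod_ge_0).
  set (r := Cmod (x, y)) in *.
  assert (Hr : 0 <= r < 1) by (split; [apply Cmod_ge_0|exact Hz]).
  set (K := (a + 2) / (1 - r) * M).
  assert (HK : 0 <= K).
  { apply Rmult_le_pos; [|assumption]. left. apply Rdiv_lt_0_compat; lra. }
  apply Cmod_le_of_inner_le. intros b1 b2 Hb. simpl fst; simpl snd.
  pose proof (is_RInt_lin _ _ _ _ _ _ b1 b2
    (is_RInt_dpoisson a g1 g2' H1 H2' x y p q Hd) (is_RInt_dpoisson a g2 g1 H2 H1 x y p q Hd)) as HJ.
  pose proof (is_RInt_scal _ _ _ K _ (RInt_kernel_mod a x y Hd)) as HB.
  assert (Hle : b1 * dpoisson_int a g1 g2' x y p q + b2 * dpoisson_int a g2 g1 x y p q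
     <= K * circ_mean (a / 2) r).
  { apply (is_RInt_le _ _ 0 (2 * PI) _ _ ltac:(lra) HJ HB). intros t _.
    unfold dpoisson_integrand, scal; simpl; unfold mult; simpl.
    set (X := rot_x x y t). set (Y := rot_y x y t).
    assert (HXY : X ^ 2 + Y ^ 2 < 1) by (unfold X, Y; now rewrite rot_norm).
    assert (Hrot : rot_x p q t ^ 2 + rot_y p q t ^ 2 = 1) by (now rewrite rot_norm).
    pose proof (dkernel_le a X Y _ _ Ha HXY Hrot) as HD.
    assert (ER : Cmod (X, Y) = r).
    { unfold r, Cmod; simpl fst; simpl snd. unfold X, Y. now rewrite rot_norm. }
    rewrite ER in HD.
    set (DR := dkernel_re a X Y (rot_x p q t) (rot_y p q t)) in *.
    set (DI := dkernel_im a X Y (rot_x p q t) (rot_y p q t)) in *.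
    pose proof (inner_le_Cmod b1 b2 ((DR, DI) * fstar (expi t))%C Hb) as Hin.
    rewrite Cmod_mult in Hin.
    replace (b1 * (DR * g1 t + DI * g2' t) + b2 * (DR * g2 t + DI * g1 t))
      with (b1 * fst ((DR, DI) * fstar (expi t))%C + b2 * snd ((DR, DI) * fstar (expi t))%C)
      by (unfold g2', g1, g2, Cmult; simpl; ring).
    apply Rle_trans with (1 := Hin).
    replace (K * kernel_mod a X Y) with (kernel_mod a X Y * ((a + 2) / (1 - r)) * M) by (unfold K; ring).
    apply Rmult_le_compat; try apply Cmod_ge_0; [exact HD|apply HM]. }
  pose proof (circ_mean_le (a / 2) r ltac:(lra) Hr) as Hmean.
  rewrite gamma_ratio_c_alpha in Hmean by assumption.
  pose proof (c_alpha_pos a Ha).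
  replace (b1 * (/ (2 * PI) * dpoisson_int a g1 g2' x y p q) + b2 * (/ (2 * PI) * dpoisson_int a g2 g1 x y p q))
    with (/ (2 * PI) * (b1 * dpoisson_int a g1 g2' x y p q + b2 * dpoisson_int a g2 g1 x y p q)) by ring.
  apply Rle_trans with (/ (2 * PI) * (K * (2 * PI * / c_alpha a))).
  - apply Rmult_le_compat_l; [lra|]. apply Rle_trans with (1 := Hle).
    now apply Rmult_le_compat_l.
  - right. unfold K. field. pose proof PI_RGT_0. repeat split; lra.
Qed.

Lemma jacobian_norm_le (z : C) : in_disk z ->
  Rbar_le (jacobian_norm f z) (Finite (M * (a + 2) / c_alpha a * (1 / (1 - Cmod z)))).
Proof.
  intros Hz. unfold jacobian_norm.
  apply (proj2 (Lub_Rbar_correct _)). intros y [v [Hv ->]]. simpl.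
  now apply jacobian_apply_le.
Qed.

End JacobianBound.

(** * The bound on the boundary function *)

(** A class closed under differentiation, so that derivatives of every order exist without being
    computed. *)
Inductive trig_poly : (R -> R) -> Prop :=
| trig_const (c : R) : trig_poly (fun _ => c)
| trig_cos : trig_poly cos
| trig_sin : trig_poly sin
| trig_plus (f g : R -> R) : trig_poly f -> trig_poly g -> trig_poly (fun t => f t + g t)
| trig_mult (f g : R -> R) : trig_poly f -> trig_poly g -> trig_poly (fun t => f t * g t).

Lemma trig_poly_derive (f : R -> R) : trig_poly f ->
  exists df, trig_poly df /\ forall t, is_derive f t (df t).
Proof.
  induction 1 as [c| | |f g Hf [df [Hdf Df]] Hg [dg [Hdg Dg]]|f g Hf [df [Hdf Df]] Hg [dg [Hdg Dg]]].
  - exists (fun _ => 0). split; [constructor|]. intros t. exact (is_derive_const c t).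
  - exists (fun t => -1 * sin t). split; [repeat constructor|].
    intros t. auto_derive; trivial. ring.
  - exists cos. split; [constructor|]. intros t. auto_derive; trivial. ring.
  - exists (fun t => df t + dg t). split; [now constructor|].
    intros t. exact (is_derive_plus f g t _ _ (Df t) (Dg t)).
  - exists (fun t => df t * g t + f t * dg t). split; [repeat constructor; assumption|].
    intros t. exact (is_derive_mult f g t _ _ (Df t) (Dg t) Rmult_comm).
Qed.

Lemma trig_poly_ex_derive_n (f : R -> R) (n : nat) (t : R) : trig_poly f -> ex_derive_n f n t.
Proof.
  intros Hf.
  (* For positive [n], [ex_derive_n f n] asks for differentiability of the derivative of order
     [n - 1]; for [n = 0] it is [True]. *)
  assert (H : exists g, trig_poly g /\ forall x, Derive_n f (pred n) x = g x).
  { induction (pred n) as [|m [g [Hg Eg]]]; [now exists f|].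
    destruct (trig_poly_derive g Hg) as [dg [Hdg Dg]].
    exists dg. split; [assumption|]. intros x. simpl.
    rewrite (Derive_ext _ g x Eg). apply is_derive_unique, Dg. }
  destruct n as [|n]; [exact I|]. simpl in *.
  destruct H as [g [Hg Eg]]. apply (ex_derive_ext g); [intros; symmetry; apply Eg|].
  destruct (trig_poly_derive g Hg) as [dg [_ Dg]]. exists (dg t). apply Dg.
Qed.

Lemma trig_poly_pow (f : R -> R) (n : nat) : trig_poly f -> trig_poly (fun t => f t ^ n).
Proof.
  intros Hf. induction n as [|n IH]; simpl; [constructor|].
  apply (trig_mult f (fun t => f t ^ n)); assumption.
Qed.

(* Powers of a trigonometric bump at [t0]: they concentrate at [t0] without having compact support. *)
Definition peak (t0 t : R) : R := / 2 + / 2 * cos t0 * cos t + / 2 * sin t0 * sin t.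
Definition peak_test (t0 : R) (n : nat) (w : C) : C :=
  RtoC ((/ 2 + / 2 * cos t0 * fst w + / 2 * sin t0 * snd w) ^ n).

Lemma peak_eq (t0 t : R) : peak t0 t = (1 + cos (t - t0)) / 2.
Proof. unfold peak. rewrite cos_minus. field. Qed.

Lemma peak_ge_0 (t0 t : R) : 0 <= peak t0 t.
Proof. rewrite peak_eq. pose proof (COS_bound (t - t0)). lra. Qed.

Lemma continuous_peak_pow (t0 : R) (n : nat) (t : R) : continuous (fun t => peak t0 t ^ n) t.
Proof.
  apply (ex_derive_continuous (fun t => peak t0 t ^ n)). unfold peak. auto_derive. trivial.
Qed.

Lemma smooth_peak_test (t0 : R) (n : nat) : smooth_on_circle (peak_test t0 n).
Proof.
  intros k t. unfold peak_test, expi, RtoC; simpl. split; apply trig_poly_ex_derive_n.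
  - apply (trig_poly_pow (fun s => / 2 + / 2 * cos t0 * cos s + / 2 * sin t0 * sin s)).
    apply (trig_plus (fun s => / 2 + / 2 * cos t0 * cos s) (fun s => / 2 * sin t0 * sin s)).
    + apply (trig_plus (fun s => / 2) (fun s => / 2 * cos t0 * cos s)); [constructor|].
      apply (trig_mult (fun s => / 2 * cos t0) cos); constructor.
    + apply (trig_mult (fun s => / 2 * sin t0) sin); constructor.
  - constructor.
Qed.

Lemma circle_pairing_peak (g : C -> C) (t0 b1 b2 : R) (n : nat) :
  (forall t, continuous (fun t => fst (g (expi t))) t) ->
  (forall t, continuous (fun t => snd (g (expi t))) t) ->
  b1 * fst (circle_pairing g (peak_test t0 n)) + b2 * snd (circle_pairing g (peak_test t0 n))
  = / (2 * PI) * RInt (fun t => (b1 * fst (g (expi t)) + b2 * snd (g (expi t))) * peak t0 t ^ n) 0 (2 * PI).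
Proof.
  intros H1 H2. unfold circle_pairing.
  assert (E : forall t, (g (expi t) * peak_test t0 n (expi t))%C
     = (fst (g (expi t)) * peak t0 t ^ n, snd (g (expi t)) * peak t0 t ^ n)).
  { intros t. unfold peak_test, peak, expi, Cmult, RtoC; simpl. f_equal; ring. }
  assert (X1 : ex_RInt (fun t => fst (g (expi t)) * peak t0 t ^ n) 0 (2 * PI)).
  { apply ex_RInt_everywhere. intros t.
    apply (continuous_mult (fun t => fst (g (expi t))) (fun t => peak t0 t ^ n)); [apply H1|apply continuous_peak_pow]. }
  assert (X2 : ex_RInt (fun t => snd (g (expi t)) * peak t0 t ^ n) 0 (2 * PI)).
  { apply ex_RInt_everywhere. intros t.
    apply (continuous_mult (fun t => snd (g (expi t))) (fun t => peak t0 t ^ n)); [apply H2|apply continuous_peak_pow]. }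
  rewrite (CRInt_pair _ _ _ 0 (2 * PI) E X1 X2).
  pose proof (is_RInt_lin _ _ _ _ _ _ b1 b2 (RInt_correct _ _ _ X1) (RInt_correct _ _ _ X2)) as HI.
  assert (HI' : is_RInt (fun t => (b1 * fst (g (expi t)) + b2 * snd (g (expi t))) * peak t0 t ^ n) 0 (2 * PI)
     (b1 * RInt (fun t => fst (g (expi t)) * peak t0 t ^ n) 0 (2 * PI) + b2 * RInt (fun t => snd (g (expi t)) * peak t0 t ^ n) 0 (2 * PI))).
  { revert HI. apply is_RInt_ext. intros t _. eq_R. ring. }
  rewrite (RInt_of_is_RInt _ _ _ _ HI').
  unfold Cmult, RtoC; simpl. ring.
Qed.

(** Near [t0] the integral gains at least a multiple of [q1^n], while far from [t0] it loses at most
    a multiple of [q^n]. Since [q < q1], the gain wins for large [n]. *)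
Lemma RInt_peak_contradiction (h : R -> R) (t0 : R) :
  (forall t, continuous h t) -> (forall t, h (t + 2 * PI) = h t) -> 0 < h t0 ->
  (forall n, RInt (fun t => h t * peak t0 t ^ n) 0 (2 * PI) <= 0) -> False.
Proof.
  intros Hc Hper Hpos Hle.
  pose proof PI_RGT_0 as Hpi. pose proof PI2_1 as Hpi1.
  set (eta := h t0 / 2). assert (Heta : 0 < eta) by (unfold eta; lra).
  (* The cap 1 keeps [d] within [[0, PI]], where cosine decreases. *)
  assert (Hnear : exists d, 0 < d <= 1 /\ forall t, Rabs (t - t0) < d -> eta <= h t).
  { assert (Hl : locally t0 (fun t => eta < h t)).
    { apply (Hc t0 (fun y => eta < y)). apply (open_gt eta). unfold eta; lra. }
    destruct Hl as [e He]. exists (Rmin e 1). split.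
    - split; [apply Rmin_glb_lt; [apply cond_pos|lra]|apply Rmin_r].
    - intros t Ht. left. apply He. apply Rlt_le_trans with (1 := Ht). apply Rmin_l. }
  destruct Hnear as [d [Hd Hnear]].
  destruct (continuity_ab_min h (t0 - PI) (t0 + PI)) as [tm [Hmin _]]; [lra| |].
  { intros c _. apply continuity_pt_filterlim. apply Hc. }
  set (B := Rabs (h tm)).
  assert (HB : forall t, t0 - PI <= t <= t0 + PI -> - B <= h t).
  { intros t Ht. specialize (Hmin t Ht). unfold B. pose proof (Rle_abs (- h tm)) as H.
    rewrite Rabs_Ropp in H. lra. }
  assert (HB0 : 0 <= B) by apply Rabs_pos.
  (* Within one period about [t0], the peak is at most [q] outside distance [d] and at least [q1]
     within distance [d / 2]. *)
  set (q := (1 + cos d) / 2). set (q1 := (1 + cos (d / 2)) / 2).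
  assert (Hq : 0 <= q) by (unfold q; pose proof (COS_bound d); lra).
  assert (Hqq : q < q1).
  { assert (cos d < cos (d / 2)) by (apply cos_decreasing_1; lra). unfold q, q1. lra. }
  assert (Hcos : forall s, cos (Rabs s) = cos s).
  { intros s. unfold Rabs. destruct (Rcase_abs s); [apply cos_neg|reflexivity]. }
  set (phi := fun n t => peak t0 t ^ n).
  assert (Hphi : forall n t, continuous (phi n) t) by (intros; apply continuous_peak_pow).
  assert (Hphi0 : forall n t, 0 <= phi n t) by (intros; apply pow_le, peak_ge_0).
  (* One bound for both regions: near [t0] it follows from [h >= eta], elsewhere from [h >= - B] and
     [(B + eta) phi <= (B + eta) q^n]. *)
  assert (Hpt : forall n t, t0 - PI <= t <= t0 + PI ->
     eta * phi n t - (B + eta) * q ^ n <= h t * phi n t).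
  { intros n t Ht. pose proof (Hphi0 n t) as H0. specialize (HB t Ht).
    assert (Hqn : 0 <= q ^ n) by now apply pow_le.
    destruct (Rlt_dec (Rabs (t - t0)) d) as [Hlt|Hge].
    - specialize (Hnear t Hlt). assert (eta * phi n t <= h t * phi n t) by (apply Rmult_le_compat_r; assumption).
      assert (0 <= (B + eta) * q ^ n) by (apply Rmult_le_pos; lra). lra.
    - assert (Habs : d <= Rabs (t - t0) <= PI) by (split; [lra|apply Rabs_le; lra]).
      assert (phi n t <= q ^ n).
      { unfold phi. apply pow_incr. split; [apply peak_ge_0|]. rewrite peak_eq. unfold q.
        rewrite <- (Hcos (t - t0)).
        assert (cos (Rabs (t - t0)) <= cos d) by (apply cos_decr_1; lra). lra. }
      assert ((B + eta) * phi n t <= (B + eta) * q ^ n) by (apply Rmult_le_compat_l; lra).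
      assert (- B * phi n t <= h t * phi n t) by (apply Rmult_le_compat_r; assumption).
      lra. }
  assert (Hlow : forall n, d * q1 ^ n <= RInt (phi n) (t0 - PI) (t0 + PI)).
  { intros n.
    assert (Hex : forall u v, ex_RInt (phi n) u v) by (intros; now apply ex_RInt_everywhere).
    rewrite <- (RInt_Chasles (phi n) (t0 - PI) (t0 - d / 2) (t0 + PI)) by apply Hex.
    rewrite <- (RInt_Chasles (phi n) (t0 - d / 2) (t0 + d / 2) (t0 + PI)) by apply Hex.
    assert (H1 : 0 <= RInt (phi n) (t0 - PI) (t0 - d / 2)) by (apply RInt_ge_0; [lra|apply Hex|intros; apply Hphi0]).
    assert (H2 : 0 <= RInt (phi n) (t0 + d / 2) (t0 + PI)) by (apply RInt_ge_0; [lra|apply Hex|intros; apply Hphi0]).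
    assert (H3 : RInt (fun _ => q1 ^ n) (t0 - d / 2) (t0 + d / 2) <= RInt (phi n) (t0 - d / 2) (t0 + d / 2)).
    { apply RInt_le; [lra|apply ex_RInt_const|apply Hex|]. intros t Ht.
      unfold phi. apply pow_incr. split; [lra|]. rewrite peak_eq. unfold q1.
      assert (cos (d / 2) <= cos (Rabs (t - t0))).
      { apply cos_decr_1; try lra; try apply Rabs_pos; apply Rabs_le; lra. }
      rewrite Hcos in H. lra. }
    rewrite RInt_const in H3.
    change ((t0 + d / 2 - (t0 - d / 2)) * q1 ^ n <= RInt (phi n) (t0 - d / 2) (t0 + d / 2)) in H3.
    replace (t0 + d / 2 - (t0 - d / 2)) with d in H3 by field.
    unfold plus; simpl. lra. }
  assert (Hall : forall n, eta * (d * q1 ^ n) <= 2 * PI * ((B + eta) * q ^ n)).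
  { intros n. specialize (Hlow n). specialize (Hle n).
    assert (Hch : forall t, continuous (fun t => h t * phi n t) t).
    { intros t. apply (continuous_mult h (phi n)); [apply Hc|apply Hphi]. }
    change (RInt (fun t => h t * phi n t) 0 (2 * PI) <= 0) in Hle.
    rewrite <- (RInt_periodic_shift (fun t => h t * phi n t) (t0 - PI) Hch) in Hle.
    2:{ intros t. rewrite Hper. f_equal. unfold phi. f_equal. rewrite !peak_eq.
        replace (t + 2 * PI - t0) with (t - t0 + 2 * INR 1 * PI) by (simpl; ring).
        now rewrite cos_period. }
    replace (t0 - PI + 2 * PI) with (t0 + PI) in Hle by ring.
    assert (Hex : ex_RInt (phi n) (t0 - PI) (t0 + PI)) by (now apply ex_RInt_everywhere).
    pose proof (is_RInt_lin _ _ _ _ _ _ eta (- ((B + eta) * q ^ n)) (RInt_correct _ _ _ Hex)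
      (is_RInt_const (t0 - PI) (t0 + PI) 1)) as HI.
    assert (H : eta * RInt (phi n) (t0 - PI) (t0 + PI) + - ((B + eta) * q ^ n) * (2 * PI)
       <= RInt (fun t => h t * phi n t) (t0 - PI) (t0 + PI)).
    { replace (2 * PI) with ((t0 + PI - (t0 - PI)) * 1) by ring.
      apply (is_RInt_le _ (fun t => h t * phi n t) (t0 - PI) (t0 + PI) _
        (RInt (fun t => h t * phi n t) (t0 - PI) (t0 + PI)) ltac:(lra) HI).
      - apply (RInt_correct (fun t => h t * phi n t)). now apply ex_RInt_everywhere.
      - intros t Ht. specialize (Hpt n t ltac:(lra)). lra. }
    assert (eta * (d * q1 ^ n) <= eta * RInt (phi n) (t0 - PI) (t0 + PI)) by (apply Rmult_le_compat_l; lra).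
    lra. }
  assert (Hq1 : 0 < q1) by lra.
  assert (Hx : Rabs (q / q1) < 1).
  { assert (0 <= q / q1) by (apply Rmult_le_pos; [assumption|left; now apply Rinv_0_lt_compat]).
    rewrite Rabs_pos_eq by assumption. apply Rmult_lt_reg_r with q1; [assumption|].
    unfold Rdiv. rewrite Rmult_assoc, Rinv_l by lra. lra. }
  assert (HK : 0 < 2 * PI * (B + eta)) by (apply Rmult_lt_0_compat; lra).
  assert (He : 0 < eta * d / (2 * PI * (B + eta))).
  { apply Rdiv_lt_0_compat; [apply Rmult_lt_0_compat; lra|exact HK]. }
  destruct (pow_lt_1_zero (q / q1) Hx _ He) as [N HN]. specialize (HN N (le_n N)). specialize (Hall N).
  assert (HqN : q ^ N = (q / q1) ^ N * q1 ^ N).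
  { rewrite <- Rpow_mult_distr. f_equal. field. lra. }
  assert (Hq1N : 0 < q1 ^ N) by now apply pow_lt.
  rewrite HqN in Hall.
  assert (Hz : eta * d <= 2 * PI * (B + eta) * (q / q1) ^ N).
  { apply Rmult_le_reg_r with (q1 ^ N); lra. }
  pose proof (Rle_abs ((q / q1) ^ N)) as Habs.
  assert ((q / q1) ^ N * (2 * PI * (B + eta)) < eta * d / (2 * PI * (B + eta)) * (2 * PI * (B + eta)))
    by (apply Rmult_lt_compat_r; lra).
  replace (eta * d / (2 * PI * (B + eta)) * (2 * PI * (B + eta))) with (eta * d) in H by (field; lra).
  lra.
Qed.

Lemma continuous_on_circle_of_radius (f : C -> C) (r : R) : C2_on_disk f -> 0 <= r < 1 ->
  forall t, continuous (fun t => fst (f (RtoC r * expi t)%C)) t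
         /\ continuous (fun t => snd (f (RtoC r * expi t)%C)) t.
Proof.
  intros HC2 Hr t.
  assert (Hz : in_disk (r * cos t, r * sin t)).
  { apply in_disk_sqr; simpl fst; simpl snd. pose proof (sin2_cos2 t) as H. unfold Rsqr in H. nra. }
  (* The first component of [ex_diff_n] is joint continuity of the function itself. *)
  destruct (HC2 _ Hz) as [[H1 _] [H2 _]]. simpl Re in H1, H2; simpl Im in H1, H2.
  assert (Ex : forall s, (RtoC r * expi s)%C = (r * cos s, r * sin s)).
  { intros s. unfold Cmult, RtoC, expi; simpl. f_equal; ring. }
  assert (Hx : continuous (fun s => r * cos s) t).
  { apply (ex_derive_continuous (fun s => r * cos s)). auto_derive. trivial. }
  assert (Hy : continuous (fun s => r * sin s) t).
  { apply (ex_derive_continuous (fun s => r * sin s)). auto_derive. trivial. }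
  split.
  - apply (continuous_ext (fun s => Re (f (r * cos s, r * sin s)))); [intros s; now rewrite Ex|].
    apply (continuous_comp_2 (fun s => r * cos s) (fun s => r * sin s) (fun x y => Re (f (x, y)))); try assumption.
    apply continuity_2d_pt_filterlim in H1. exact H1.
  - apply (continuous_ext (fun s => Im (f (r * cos s, r * sin s)))); [intros s; now rewrite Ex|].
    apply (continuous_comp_2 (fun s => r * cos s) (fun s => r * sin s) (fun x y => Im (f (x, y)))); try assumption.
    apply continuity_2d_pt_filterlim in H2. exact H2.
Qed.

(** Convergence to [fstar] is only distributional, so bounds pass to the limit through pairings with
    nonnegative test functions. If [|fstar| > 1] at [t0], the component of [fstar] along its
    direction there exceeds 1 at [t0], while the same component of each [f_r] stays at most 1. *)
Lemma boundary_le_1 (f fstar : C -> C) :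
  C2_on_disk f -> distributional_limit f fstar -> continuous_on on_circle fstar ->
  (forall z, in_disk z -> in_disk (f z)) -> forall t, Cmod (fstar (expi t)) <= 1.
Proof.
  intros HC2 Hlim Hcont Hmap t0. apply Rnot_lt_le. intros Hgt.
  destruct (polar_form (fstar (expi t0))) as [tau Htau].
  set (b1 := cos tau) in *. set (b2 := sin tau) in *.
  assert (Hb : b1 ^ 2 + b2 ^ 2 = 1).
  { pose proof (sin2_cos2 tau) as H. unfold Rsqr in H. fold b1 b2 in H. lra. }
  set (inner := fun w : C => b1 * fst w + b2 * snd w).
  set (h := fun t => inner (fstar (expi t)) - 1).
  assert (Hinner : forall w, Cmod w <= 1 -> inner w <= 1).
  { intros w Hw. apply Rle_trans with (2 := Hw). now apply inner_le_Cmod. }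
  assert (HF : forall t, continuous (fun t => fst (fstar (expi t))) t) by apply (continuous_boundary fstar Hcont).
  assert (HS : forall t, continuous (fun t => snd (fstar (expi t))) t) by apply (continuous_boundary fstar Hcont).
  assert (Hci : forall t, continuous (fun t => inner (fstar (expi t))) t).
  { intros t. apply (continuous_plus (fun t => b1 * fst (fstar (expi t))) (fun t => b2 * snd (fstar (expi t)))).
    - apply (continuous_scal_r b1 (fun t => fst (fstar (expi t)))), HF.
    - apply (continuous_scal_r b2 (fun t => snd (fstar (expi t)))), HS. }
  pose proof two_PI_pos as Hpi. assert (Hpi' : 0 < / (2 * PI)) by (apply Rinv_0_lt_compat; assumption).
  apply (RInt_peak_contradiction h t0).
  - intros t. apply (continuous_minus (fun t => inner (fstar (expi t))) (fun _ => 1)); [apply Hci|apply continuous_const].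
  - intros t. unfold h, expi. do 3 f_equal.
    now rewrite cos_plus, sin_plus, cos_2PI, sin_2PI, !Rmult_1_r, !Rmult_0_r, Rminus_0_r, Rplus_0_r.
  - unfold h, inner. rewrite Htau at 1 2; simpl fst; simpl snd.
    replace (b1 * (Cmod (fstar (expi t0)) * b1) + b2 * (Cmod (fstar (expi t0)) * b2))
      with (Cmod (fstar (expi t0)) * (b1 ^ 2 + b2 ^ 2)) by ring.
    rewrite Hb. lra.
  - intros n.
    specialize (Hlim (peak_test t0 n) (smooth_peak_test t0 n)).
    assert (Hl : filterlim (fun r : R => inner (circle_pairing (fun w => f (RtoC r * w)%C) (peak_test t0 n)))
      (at_left 1) (locally (inner (circle_pairing fstar (peak_test t0 n))))).
    { apply (filterlim_comp _ _ _ _ inner _ _ _ Hlim).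
      apply (continuous_plus (fun w : C => b1 * fst w) (fun w : C => b2 * snd w)).
      - apply (continuous_scal_r b1 (fun w : C => fst w)). apply continuous_fst.
      - apply (continuous_scal_r b2 (fun w : C => snd w)). apply continuous_snd. }
    (* The pairing of the constant 1 with the peak, an upper bound for every [r] in [(0, 1)]. *)
    set (A := / (2 * PI) * RInt (fun t => peak t0 t ^ n) 0 (2 * PI)).
    assert (Hex : ex_RInt (fun t => peak t0 t ^ n) 0 (2 * PI)).
    { apply ex_RInt_everywhere. apply continuous_peak_pow. }
    assert (Hle : Rbar_le (inner (circle_pairing fstar (peak_test t0 n))) A).
    { apply (filterlim_le (F := at_left 1)
        (fun r : R => inner (circle_pairing (fun w => f (RtoC r * w)%C) (peak_test t0 n))) (fun _ => A)).
      - exists (mkposreal 1 Rlt_0_1). intros r Hr Hr1.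
        unfold ball in Hr; simpl in Hr; unfold AbsRing_ball, abs, minus, plus, opp in Hr; simpl in Hr.
        apply Rabs_def2 in Hr.
        assert (Hr01 : 0 <= r < 1) by lra.
        pose proof (continuous_on_circle_of_radius f r HC2 Hr01) as Hcr.
        unfold inner. rewrite (circle_pairing_peak (fun w => f (RtoC r * w)%C)) by (intros t; apply (Hcr t)).
        apply Rmult_le_compat_l; [lra|]. apply RInt_le; [lra| |exact Hex|].
        + apply ex_RInt_everywhere. intros t.
          apply (continuous_mult (fun t => b1 * fst (f (RtoC r * expi t)%C) + b2 * snd (f (RtoC r * expi t)%C)) (fun t => peak t0 t ^ n));
            [|apply continuous_peak_pow].
          apply (continuous_plus (fun t => b1 * fst (f (RtoC r * expi t)%C)) (fun t => b2 * snd (f (RtoC r * expi t)%C))).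
          * apply (continuous_scal_r b1 (fun t => fst (f (RtoC r * expi t)%C))), Hcr.
          * apply (continuous_scal_r b2 (fun t => snd (f (RtoC r * expi t)%C))), Hcr.
        + intros t _. rewrite <- (Rmult_1_l (peak t0 t ^ n)) at 2.
          apply Rmult_le_compat_r; [apply pow_le, peak_ge_0|]. apply Hinner. left. apply Hmap.
          unfold in_disk. rewrite Cmod_mult, Cmod_expi, Cmod_R, Rabs_pos_eq; lra.
      - exact Hl.
      - apply filterlim_const. }
    simpl in Hle. unfold inner in Hle. rewrite circle_pairing_peak in Hle by assumption.
    unfold A in Hle. apply Rmult_le_reg_l in Hle; [|assumption].
    assert (Hex2 : ex_RInt (fun t => inner (fstar (expi t)) * peak t0 t ^ n) 0 (2 * PI)).
    { apply ex_RInt_everywhere. intros t.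
      apply (continuous_mult (fun t => inner (fstar (expi t))) (fun t => peak t0 t ^ n)); [apply Hci|apply continuous_peak_pow]. }
    pose proof (is_RInt_lin _ _ _ _ _ _ 1 (-1) (RInt_correct _ _ _ Hex2) (RInt_correct _ _ _ Hex)) as HI.
    rewrite (RInt_ext _ (fun t => 1 * (inner (fstar (expi t)) * peak t0 t ^ n) + -1 * peak t0 t ^ n)).
    + rewrite (RInt_of_is_RInt _ _ _ _ HI). unfold inner. lra.
    + intros t _. unfold h. eq_R. ring.
Qed.

(** * The derivative estimate for alpha-harmonic functions *)

Theorem theorem1p1 :
  forall (alpha : R) (f fstar : C -> C),
    -1 < alpha ->
    alpha_harmonic alpha f ->
    has_boundary_function alpha f fstar ->
    continuous_on on_circle fstar ->
    (forall M : R,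
        Rbar_le (sup_closed_disk (closed_disk_extension f fstar)) (Finite M) ->
        forall z : C, in_disk z ->
          Rbar_le (jacobian_norm f z)
            (Finite (M * (alpha + 2) / c_alpha alpha * (1 / (1 - Cmod z)))) /\
          M * (alpha + 2) / c_alpha alpha * (1 / (1 - Cmod z)) <=
          2 * M * (alpha + 2) / c_alpha alpha * (1 / (1 - Cmod z ^ 2))) /\
    ((forall z : C, in_disk z -> in_disk (f z)) ->
        forall z : C, in_disk z ->
          Rbar_le (jacobian_norm f z)
            (Finite (2 * (alpha + 2) / c_alpha alpha * (1 / (1 - Cmod z ^ 2))))).
Proof.
  intros alpha f fstar Ha [HC2 _] [Hlim Hrep] Hcont.
  pose proof (c_alpha_pos alpha Ha) as Hc.
  (* With [r = |z|], this is [1 / (1 - r) = (1 + r) / (1 - r^2)] together with [1 + r <= 2];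
     [M >= 0] preserves the direction. *)
  assert (Hsecond : forall M z, 0 <= M -> in_disk z ->
    M * (alpha + 2) / c_alpha alpha * (1 / (1 - Cmod z)) <=
    2 * M * (alpha + 2) / c_alpha alpha * (1 / (1 - Cmod z ^ 2))).
  { intros M z HM Hz. unfold in_disk in Hz. pose proof (Cmod_ge_0 z). set (r := Cmod z) in *.
    replace (M * (alpha + 2) / c_alpha alpha * (1 / (1 - r)))
      with (M * (alpha + 2) / c_alpha alpha * (1 / (1 - r ^ 2)) * (1 + r))
      by (field; repeat split; nra).
    replace (2 * M * (alpha + 2) / c_alpha alpha * (1 / (1 - r ^ 2)))
      with (M * (alpha + 2) / c_alpha alpha * (1 / (1 - r ^ 2)) * 2)
      by (field; repeat split; nra).
    apply Rmult_le_compat_l; [|lra]. apply Rmult_le_pos.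
    - apply Rmult_le_pos; [apply Rmult_le_pos; lra|left; now apply Rinv_0_lt_compat].
    - left. apply Rdiv_lt_0_compat; nra. }
  split.
  - intros M HM z Hz.
    (* The supremum runs over the closed disk, and on the circle the extension takes the values of
       [fstar]. *)
    assert (Hbd : forall t, Cmod (fstar (expi t)) <= M).
    { intros t.
      assert (H : Rbar_le (Finite (Cmod (fstar (expi t)))) (sup_closed_disk (closed_disk_extension f fstar))).
      { apply (proj1 (Lub_Rbar_correct _)). exists (expi t). split.
        - unfold in_closed_disk. rewrite Cmod_expi. lra.
        - unfold closed_disk_extension. rewrite Cmod_expi. destruct (Rlt_dec 1 1); [lra|reflexivity]. }
      exact (Rbar_le_trans _ _ _ H HM). }
    split; [now apply (jacobian_norm_le alpha M f fstar)|].
    (* [M] is nonnegative because it bounds a modulus. *)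
    apply Hsecond; [|assumption]. apply Rle_trans with (2 := Hbd 0). apply Cmod_ge_0.
  - intros Hmap z Hz.
    pose proof (jacobian_norm_le alpha 1 f fstar Ha Hrep Hcont
      (boundary_le_1 f fstar HC2 Hlim Hcont Hmap) z Hz) as H.
    apply Rbar_le_trans with (1 := H). simpl.
    pose proof (Hsecond 1 z Rle_0_1 Hz) as H2.
    now rewrite Rmult_1_r in H2.
Qed.
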